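(* Let $q \geq 2$ be a fixed prime power and let $f$ be a random Rademacher multiplicative function over $\mathbb{F}_q[t]$. Let $k = k(n) \geq 1$ be integers satisfying $k = o(\log n)$ as $n \to \infty$. Then \[ \frac{1}{\sqrt{|\mathcal{P}_k(n)|}} \sum_{F \in \mathcal{P}_k(n)} f(F) \] converges in distribution to the standard normal distribution $N(0,1)$ as $n \to \infty$.
   Context: $\mathcal{M}$ denotes the set of monic polynomials in $\mathbb{F}_q[t]$. A random Rademacher multiplicative function $f:\mathcal{M}\to\{-1,0,1\}$ is obtained by choosing independent random variables $f(P)$, each uniformly distributed on $\{\pm1\}$, for the monic irreducible polynomials $P$, setting $f(P_1\cdots P_m)=f(P_1)\cdots f(P_m)$ for distinct monic irreducibles $P_1,\dots,P_m$ (with $f(1)=1$), and $f(F)=0$ for non-squarefree $F$. For integers $k,n\ge1$, $\mathcal{P}_k(n)$ is the set of squarefree $F\in\mathcal{M}$ with exactly $k$ distinct irreducible factors and $\deg F = n$. *)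

(* Defs.v *)
From HB Require Import structures.
From mathcomp Require Import all_boot all_order all_algebra all_field.
From mathcomp Require Import all_classical all_reals all_analysis.
From mathcomp Require Import normal_distribution.
Set Implicit Arguments. Unset Strict Implicit. Unset Printing Implicit Defensive.
Import Order.TTheory GRing.Theory Num.Theory.
Local Open Scope ring_scope.

Section FqT.
Variable F : finFieldType.

Definition monic_deg (d : nat) : seq {poly F} :=
  [seq 'X^d + Poly (tval t) | t <- enum {: d.-tuple F}].

Definition irr_upto (n : nat) : seq {poly F} :=
  [seq P <- flatten [seq monic_deg d | d <- iota 0 n.+1]
     | `[< irreducible_poly P >]].

(* deg G = (size G).-1; all monic irreducible divisors of a nonzero G have
   degree <= deg G, so this counts ALL distinct monic irreducible factors. *)
Definition nb_irr_factors (G : {poly F}) : nat :=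
  count (fun P => P %| G) (irr_upto (size G).-1).

Definition squarefree (G : {poly F}) : Prop :=
  forall P : {poly F}, irreducible_poly P -> ~~ (P ^+ 2 %| G).

Definition Pkn (k n : nat) : seq {poly F} :=
  [seq G <- monic_deg n | `[< squarefree G >] && (nb_irr_factors G == k)].

(* A sign assignment to the monic irreducibles of degree <= n:
   eps i = true means f(P_i) = -1, where P_i = nth 0 (irr_upto n) i. *)
Definition signs (n : nat) := {ffun 'I_(size (irr_upto n)) -> bool}.

Definition rad_mult (R : ringType) (n : nat) (eps : signs n) (G : {poly F}) : R :=
  if `[< squarefree G >] then
    \prod_(i < size (irr_upto n) | nth 0 (irr_upto n) i %| G) (-1) ^+ eps i
  else 0.

Definition normalized_sum (R : realType) (k n : nat) (eps : signs n) : R :=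
  (Num.sqrt (size (Pkn k n))%:R)^-1 * \sum_(G <- Pkn k n) rad_mult R eps G.

(* Distribution function of the normalised sum, when the f(P), P monic
   irreducible of degree <= n, are independent uniform on {+-1}
   (i.e. eps is uniform on the finite set signs n). *)
Definition cdf_sum (R : realType) (k n : nat) (x : R) : R :=
  #|[set eps : signs n | normalized_sum R k eps <= x]|%:R /
  (#|{: signs n}|)%:R.

End FqT.

(* Main.v *)
Require Import Defs.
From HB Require Import structures.
From mathcomp Require Import all_boot all_order all_algebra all_field.
From mathcomp Require Import all_classical all_reals all_analysis.
From mathcomp Require Import normal_distribution.
From mathcomp Require Import ring lra zify.
Import Order.TTheory GRing.Theory Num.Theory numFieldNormedType.Exports.
Local Open Scope ring_scope.
Local Open Scope classical_set_scope.

Set Implicit Arguments. Unset Strict Implicit. Unset Printing Implicit Defensive.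

(** Call a prime P big if deg P >= 3n/4; a product of degree n has at most one big
    factor.  As k = o(log n), the products without a big factor are negligible in
    mean square, so up to that error the sum is a sum over the big primes P of
    f(P) a(P), where a(P) only involves small primes and is the sum of f over the
    products of k - 1 primes of degree n - deg P.  Given the f(P) of the small primes
    this is a sum of independent terms, each at most q^(n/4), with conditional variance
    V, the sum of the a(P)^2.  Replacing the big signs one by one with a step of the heat
    flow of the normal distribution function (Lindeberg) compares it with N(0, V).
    The Fourier expansion of V shows that V / |P_k(n)| tends to 1 in mean square: the
    coefficients count pairs of products of equal degree, which are controlled by the
    coefficients of (1 - x)^(- 1/4). *)

(** The hypothesis k = o(log n) acts through one ratio. Let L be the sum of q^(- deg P) over the
    primes of degree at most n; it is at least (log n) / 2. If k - 1 <= th * L, then sets of k - 2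
    primes have at most 2 * th times the total weight of sets of k - 1 primes, and all errors but
    Lindeberg's are of order th or sqrt th. The threshold 3n/4 keeps each a(P) far below the square
    root of |P_k(n)|, which is at least q^(n/2) / (2 * sqrt n). The delicate point is the variance.
    Divided by q^D, the number of products of r primes of total degree D is at most the coefficient
    of x^D in (log (1 / (1 - x)))^r / r!. Its squares must be summed over D at a cost exponential in
    r, which powers of th then absorb. As (1 - x)^(- u) is the exponential of u * log (1 / (1 - x)),
    that coefficient is at most u^(- r) times the one of (1 - x)^(- u), whose squares are summable
    exactly for u < 1/2; hence u = 1/4. *)

(** * The normal distribution function and its heat flow *)

Section NormalCdf.
Variable R : realType.
Implicit Types x y z s a c t : R.

Notation phi := (normal_pdf (0 : R) 1).

Definition ncdf (y : R) : R := fine (normal_prob (0 : R) 1 `]-oo, y]).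

Lemma ncdfE y : normal_prob (0 : R) 1 `]-oo, y] = (ncdf y)%:E.
Proof. by rewrite /ncdf fineK// fin_num_measure. Qed.

Lemma phiE x : phi x = normal_peak 1 * expR (- x ^+ 2 / 2).
Proof.
rewrite normal_pdfE ?oner_eq0// /normal_fun subr0 expr1n.
by [].
Qed.

Lemma continuous_phi : continuous phi.
Proof. by apply: continuous_normal_pdf; rewrite oner_eq0. Qed.

Lemma is_derive_ncdf y : is_derive y 1 ncdf (phi y).
Proof.
have intphi : (@lebesgue_measure R).-integrable [set: R] (EFin \o phi).
  exact: integrable_normal_pdf.
have iphi : (@lebesgue_measure R).-integrable
    [set` Interval -oo%O (BRight (y + 1))] (EFin \o phi).
  exact: integrableS intphi.
have [] := @continuous_FTC1 R phi -oo%O y (y + 1) _ iphi _ (@continuous_phi y).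
- by rewrite ltrDl.
- by rewrite ltNyr.
by rewrite derive1E => df <-; exact: DeriveDef.
Qed.

Lemma ncdf_ge0 y : 0 <= ncdf y.
Proof. exact: fine_ge0. Qed.

Lemma ncdf_le1 y : ncdf y <= 1.
Proof. by rewrite -lee_fin -ncdfE probability_le1. Qed.

Lemma mvt_bound (f f' : R -> R) (a b M : R) : a <= b ->
  (forall x, a <= x <= b -> is_derive x 1 f (f' x)) ->
  (forall x, a <= x <= b -> `|f' x| <= M) ->
  `|f b - f a| <= M * (b - a).
Proof.
move=> ab df bf'.
have [||c cab ->] := @MVT_segment R f f' a b ab.
- by move=> x; rewrite in_itv/= => /andP[ax xb]; apply: df; rewrite !ltW.
- apply: derivable_within_continuous => x; rewrite in_itv/= => xab.
  by have [] := df x xab.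
by rewrite normrM [`|b - a|]ger0_norm ?subr_ge0// ler_wpM2r ?subr_ge0 ?bf'.
Qed.

Lemma is_derive_phi x : is_derive x 1 phi (- x * phi x).
Proof.
rewrite (_ : phi = fun x => normal_peak 1 * expR (- x ^+ 2 / 2)); last first.
  by apply/funext => t; rewrite phiE.
have dX : is_derive x (1 : R) (fun t : R => - t ^+ 2 / 2) (- x).
  apply: is_derive_eq.
  by rewrite /GRing.scale/=; lra.
have dE := @is_derive1_comp R expR (fun t => - t ^+ 2 / 2) x _ _
  (is_derive_expR (- x ^+ 2 / 2)) dX.
apply: is_derive_eq; rewrite /GRing.scale/=; ring.
Qed.

Lemma is_derive_phi' x :
  is_derive x 1 (fun t => - t * phi t) ((x ^+ 2 - 1) * phi x).
Proof.
have d := is_derive_phi x.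
apply: is_derive_eq; rewrite /GRing.scale/=; ring.
Qed.

Lemma phi_ge0 x : 0 <= phi x. Proof. exact: normal_pdf_ge0. Qed.

Lemma peak_le1 : normal_peak (1 : R) <= 1.
Proof.
rewrite /normal_peak invf_le1 ?sqrtr_gt0; last first.
  by rewrite expr1n mul1r mulrn_wgt0 ?pi_gt0.
rewrite -[X in X <= _]sqrtr1 ler_wsqrtr// expr1n mul1r.
have := pi_ge2 R; lra.
Qed.

Lemma phi_le1 x : phi x <= 1.
Proof.
by rewrite (le_trans _ peak_le1)// normal_pdf_ub// oner_eq0.
Qed.

Lemma sqr_phi_le2 x : x ^+ 2 * phi x <= 2.
Proof.
have h : x ^+ 2 / 2 * expR (- x ^+ 2 / 2) <= 1.
  rewrite mulNr expRN ler_pdivrMr ?expR_gt0// mul1r.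
  by have := expR_ge1Dx (x ^+ 2 / 2); lra.
have h0 : 0 <= x ^+ 2 / 2 * expR (- x ^+ 2 / 2).
  by rewrite mulr_ge0 ?expR_ge0// divr_ge0 ?sqr_ge0.
rewrite phiE mulrCA.
have p0 := normal_peak_ge0 (1 : R).
have := ler_pM p0 h0 peak_le1 h; lra.
Qed.

Lemma phi''_bound x : `|(x ^+ 2 - 1) * phi x| <= 2.
Proof.
have := sqr_phi_le2 x; have := phi_ge0 x; have := phi_le1 x.
have : 0 <= x ^+ 2 * phi x by rewrite mulr_ge0 ?sqr_ge0 ?phi_ge0.
by rewrite ler_norml => *; apply/andP; split; lra.
Qed.

Lemma phi'_lip x y : `|- x * phi x - (- y * phi y)| <= 2 * `|x - y|.
Proof.
wlog xy : x y / y <= x.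
  move=> H; case: (leP y x) => [/H//|/ltW/H]; by rewrite distrC [`|x - y|]distrC.
rewrite [`|x - y|]ger0_norm ?subr_ge0//.
apply: (@mvt_bound (fun t => - t * phi t) (fun t => (t ^+ 2 - 1) * phi t)) => //.
  by move=> t _; exact: is_derive_phi'.
by move=> t _; exact: phi''_bound.
Qed.

(** The left side is the error of the trapezoidal rule for the integral of phi' over [t - d, t + d],
    because phi' x = - x * phi x. The Lipschitz bound on phi' makes it of second order. *)
Lemma phi_trapezoid t (d : R) : 0 <= d ->
  `|phi (t + d) - phi (t - d)
    + d * ((t + d) * phi (t + d) + (t - d) * phi (t - d))| <= 8 * d ^+ 2.
Proof.
move=> d0; have td : t - d <= t + d by lra.
have [||c] := @MVT_segment R phi (fun t => - t * phi t) (t - d) (t + d) td.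
- by move=> x _; exact: is_derive_phi.
- by apply: continuous_subspaceT; exact: continuous_phi.
rewrite in_itv/= => /andP[c1 c2] ->.
have -> : - c * phi c * (t + d - (t - d)) +
  d * ((t + d) * phi (t + d) + (t - d) * phi (t - d)) =
  d * ((- c * phi c - (- (t + d) * phi (t + d))) +
       (- c * phi c - (- (t - d) * phi (t - d)))) by ring.
rewrite normrM ger0_norm// (_ : 8 * d ^+ 2 = d * (8 * d)); last by ring.
rewrite ler_wpM2l//.
apply: (le_trans (ler_normD _ _)).
have h1 := phi'_lip c (t + d); have h2 := phi'_lip c (t - d).
have h3 : `|c - (t + d)| <= 2 * d by rewrite ler_norml; lra.
have h4 : `|c - (t - d)| <= 2 * d by rewrite ler_norml; lra.
lra.
Qed.

Lemma ncdf_lip x y : `|ncdf x - ncdf y| <= `|x - y|.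
Proof.
wlog xy : x y / y <= x.
  move=> H; case: (leP y x) => [/H//|/ltW/H]; by rewrite distrC [`|x - y|]distrC.
rewrite [`|x - y|]ger0_norm ?subr_ge0// -[leRHS]mul1r.
apply: (@mvt_bound ncdf phi) => //.
  by move=> t _; exact: is_derive_ncdf.
by move=> t _; rewrite ger0_norm ?phi_le1 ?phi_ge0.
Qed.

Lemma ncdf_homo : {homo ncdf : x y / x <= y}.
Proof.
move=> x y xy; rewrite -lee_fin -!ncdfE.
by apply: le_measure; rewrite ?inE//; apply: subitvPr; rewrite bnd_simp.
Qed.

(** For s > 0, the distribution function of N(0, s) at z. It solves the heat equation, so adding an
    independent normal variable of variance c raises s by c. *)
Definition heat s z : R := ncdf (z / Num.sqrt s).

Lemma heat_ge0 s z : 0 <= heat s z. Proof. exact: ncdf_ge0. Qed.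
Lemma heat_le1 s z : heat s z <= 1. Proof. exact: ncdf_le1. Qed.

Lemma heat_homo s : {homo heat s : x y / x <= y}.
Proof.
move=> x y xy; apply: ncdf_homo; by rewrite ler_wpM2r// invr_ge0 sqrtr_ge0.
Qed.

Lemma heat_lip s x y : `|heat s x - heat s y| <= `|x - y| / Num.sqrt s.
Proof.
apply: (le_trans (ncdf_lip _ _)).
by rewrite -mulrBl normrM normfV (ger0_norm (sqrtr_ge0 _)).
Qed.

Lemma heat_lip_var s a c z : 0 < s -> s <= a -> s <= c ->
  `|heat a z - heat c z| <= `|z| / (s * Num.sqrt s) * `|a - c|.
Proof.
move=> s0 sa sc; apply: (le_trans (ncdf_lip _ _)).
have a0 : 0 < Num.sqrt a by rewrite sqrtr_gt0; lra.
have c0 : 0 < Num.sqrt c by rewrite sqrtr_gt0; lra.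
have q0 : 0 < Num.sqrt s by rewrite sqrtr_gt0.
have qa : Num.sqrt s <= Num.sqrt a by rewrite ler_wsqrtr.
have qc : Num.sqrt s <= Num.sqrt c by rewrite ler_wsqrtr.
have ea : Num.sqrt a ^+ 2 = a by rewrite sqr_sqrtr//; lra.
have ec : Num.sqrt c ^+ 2 = c by rewrite sqr_sqrtr//; lra.
have es : Num.sqrt s ^+ 2 = s by rewrite sqr_sqrtr//; lra.
move: a0 c0 q0 qa qc ea ec es.
move: (Num.sqrt a) (Num.sqrt c) (Num.sqrt s) => A C S A0 C0 S0 SA SC <- <- <-.
have -> : z / A - z / C = z * ((C - A) / (A * C)) by field; lra.
have -> : A ^+ 2 - C ^+ 2 = (A - C) * (A + C) by ring.
rewrite normrM -mulrA ler_wpM2l// !normrM normfV distrC.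
rewrite [leRHS]mulrCA ler_wpM2l// !gtr0_norm ?mulr_gt0 ?addr_gt0//.
rewrite [leRHS]mulrC ler_pdivlMr; last by rewrite mulr_gt0// exprn_gt0.
rewrite mulrC ler_pdivrMr ?mulr_gt0//.
have h1 : S * S <= A * C by apply: ler_pM => //; exact: ltW.
have : S * S * S <= A * C * (A + C).
  apply: ler_pM => //; [exact: mulr_ge0 (ltW _) (ltW _) | exact: ltW|lra].
by rewrite expr2; lra.
Qed.


(** The identity as a random variable under [normal_prob]: its [cdf] is [ncdf], which gives the
    limits of [ncdf] at both ends. *)
Let idTR : measurableTypeR R -> R := idfun.

#[local] HB.instance Definition _ :=
  @isMeasurableFun.Build _ _ _ _ idTR (@measurable_id _ _ setT).
(** Interpolate by [U t], the average of [heat (C - t ^+ 2)] at z + t and z - t: the variance lost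
    is that of a random sign times t. After scaling by [p t], the derivative of [U] is the error in
    [phi_trapezoid] with centre [z * p t] and half-width [t * p t], hence at most 4 * t^2 * (p
    t)^3. *)
Lemma heat_step s z a : 0 < s ->
  `|(heat s (z + a) + heat s (z - a)) / 2 - heat (s + a ^+ 2) z|
    <= 4 * `|a| ^+ 3 / (s * Num.sqrt s).
Proof.
move=> s0; wlog a0 : a / 0 <= a.
  move=> H; case: (leP 0 a) => [/H//|/ltW an].
  have := H (- a); rewrite oppr_ge0 => /(_ an).
  by rewrite sqrrN normrN opprK [heat s (z - a) + _]addrC.
rewrite (ger0_norm a0).
pose C := s + a ^+ 2.
pose p t := (Num.sqrt (C - t ^+ 2))^-1.
pose U t := (ncdf ((z + t) * p t) + ncdf ((z - t) * p t)) / 2.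
pose U' t := p t / 2 * (phi ((z + t) * p t) - phi ((z - t) * p t) +
   (t * p t) * ((z + t) * p t * phi ((z + t) * p t)
     + (z - t) * p t * phi ((z - t) * p t))).
have UE : (heat s (z + a) + heat s (z - a)) / 2 - heat (s + a ^+ 2) z
    = U a - U 0.
  rewrite /U /p /C /heat addrK !expr0n subr0 addr0 subr0.
  by congr (_ - _); rewrite [RHS]mulrDl -splitr.
have Cs t : 0 <= t <= a -> s <= C - t ^+ 2.
  by move=> /andP[t0 ta]; rewrite /C lerBrDr lerD2l ler_pXn2r// ?nnegrE.
have q0 : 0 < Num.sqrt s by rewrite sqrtr_gt0.
have ple t : 0 <= t <= a -> 0 < p t /\ p t <= (Num.sqrt s)^-1.
  move=> tA; have h := Cs _ tA.
  have ct : 0 < Num.sqrt (C - t ^+ 2) by rewrite sqrtr_gt0 (lt_le_trans s0).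
  by rewrite /p invr_gt0 lef_pV2 ?posrE// ler_wsqrtr.
have dU t : 0 <= t <= a -> is_derive t 1 U (U' t).
  move=> tA.
  have ct0 : 0 < C - t ^+ 2 by rewrite (lt_le_trans s0)// Cs.
  have ct : 0 < Num.sqrt (C - t ^+ 2) by rewrite sqrtr_gt0.
  have dC : is_derive t (1 : R) (fun t => C - t ^+ 2) (- (2 * t)).
    apply: is_derive_eq; rewrite /GRing.scale/=; ring.
  have dq : is_derive t (1 : R) (fun t => Num.sqrt (C - t ^+ 2))
     (- (t * p t)).
    have := @is_derive1_comp R Num.sqrt (fun t => C - t ^+ 2) t _ _
      (is_derive1_sqrt ct0) dC.
    move=> h; apply: (is_derive_eq h); rewrite /p; field; exact: lt0r_neq0.
  have dp : is_derive t (1 : R) p (t * p t ^+ 3).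
        have := @is_deriveV R (fun t => Num.sqrt (C - t ^+ 2)) t _ 1 (lt0r_neq0 ct) dq.
    move=> h; apply: (is_derive_eq h); rewrite /p /GRing.scale/=; field.
    exact: lt0r_neq0.
  have d1 : is_derive t (1 : R) (fun t => (z + t) * p t)
     (p t + (z + t) * (t * p t ^+ 3)).
    apply: is_derive_eq; rewrite /GRing.scale/=; ring.
  have d2 : is_derive t (1 : R) (fun t => (z - t) * p t)
     (- p t + (z - t) * (t * p t ^+ 3)).
    apply: is_derive_eq; rewrite /GRing.scale/=; ring.
  have d3 := @is_derive1_comp R ncdf (fun t => (z + t) * p t) t _ _
      (is_derive_ncdf _) d1.
  have d4 := @is_derive1_comp R ncdf (fun t => (z - t) * p t) t _ _
      (is_derive_ncdf _) d2.
  apply: is_derive_eq; rewrite /U' /GRing.scale/=; by field.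
have bU t : 0 <= t <= a -> `|U' t| <= 4 * a ^+ 2 / (s * Num.sqrt s).
  move=> tA; have [p0 pq] := ple _ tA; case/andP: tA => t0 ta.
  have tp0 : 0 <= t * p t by rewrite mulr_ge0// ltW.
  have := phi_trapezoid (z * p t) tp0.
  rewrite -mulrDl -mulrBl => tr.
  rewrite /U' normrM ger0_norm; last by rewrite divr_ge0// ltW.
  apply: (@le_trans _ _ (4 * t ^+ 2 * p t ^+ 3)).
    apply: (le_trans (ler_wpM2l _ tr)); first by rewrite divr_ge0// ltW.
    rewrite le_eqVlt; apply/orP; left; apply/eqP; by field.
  rewrite ler_pM//.
  - by rewrite mulr_ge0// sqr_ge0.
  - by rewrite exprn_ge0// ltW.
  - by rewrite ler_pM2l// ler_pXn2r// ?nnegrE.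
  have -> : (s * Num.sqrt s)^-1 = (Num.sqrt s)^-1 ^+ 3.
    rewrite -[X in (X * _)^-1](sqr_sqrtr (ltW s0)); field; exact: lt0r_neq0.
  by rewrite ler_pXn2r// ?nnegrE ?invr_ge0// ltW.
rewrite UE (_ : 4 * _ / _ = 4 * a ^+ 2 / (s * Num.sqrt s) * (a - 0)); last first.
  by rewrite subr0 exprSr; ring.
exact: mvt_bound.
Qed.

Lemma ncdf_tailR (e : R) : 0 < e -> exists y, 1 - e <= ncdf y.
Proof.
move=> e0.
have := @cvg_cdfy1 _ _ R (normal_prob (0 : R) 1) idTR.
have -> : cdf (P := normal_prob (0 : R) 1) idTR = fun y => (ncdf y)%:E.
  by apply/funext => y; rewrite -ncdfE.
move=> /fine_cvgP[_] /cvgrPdist_le /(_ _ e0) [M [_ HM]].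
exists (M + 1); have := HM (M + 1); rewrite ltrDl ltr01 => /(_ isT) /=.
by rewrite ler_norml; lra.
Qed.

Lemma ncdf_tailL (e : R) : 0 < e -> exists y, ncdf y <= e.
Proof.
move=> e0.
have := @cvg_cdfNy0 _ _ R (normal_prob (0 : R) 1) idTR.
have -> : cdf (P := normal_prob (0 : R) 1) idTR = fun y => (ncdf y)%:E.
  by apply/funext => y; rewrite -ncdfE.
move=> /fine_cvgP[_] /cvgrPdist_le /(_ _ e0) [M [_ HM]].
exists (M - 1); have := HM (M - 1); rewrite gtrDl ltrN10 => /(_ isT) /=.
by rewrite ler_norml; lra.
Qed.
End NormalCdf.

(** * Uniform random signs: means, characters and Lindeberg replacement *)

Section RandomSigns.
Variables (R : realType) (I : finType).
Implicit Types (g h : {ffun I -> bool} -> R) (e : {ffun I -> bool}) (A B : {set I}).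

Definition mean g : R := (\sum_e g e) / #|{ffun I -> bool}|%:R.

Lemma card_signs_gt0 : 0 < #|{ffun I -> bool}|%:R :> R.
Proof. by rewrite ltr0n; apply/card_gt0P; exists [ffun=> false]. Qed.

Lemma eq_mean g h : g =1 h -> mean g = mean h.
Proof. by move=> gh; rewrite /mean (eq_bigr _ (fun e _ => gh e)). Qed.

Lemma ler_mean g h : (forall e, g e <= h e) -> mean g <= mean h.
Proof.
move=> gh; rewrite ler_pM2r ?invr_gt0 ?card_signs_gt0//.
exact: ler_sum.
Qed.

Lemma meanD g h : mean (fun e => g e + h e) = mean g + mean h.
Proof. by rewrite /mean big_split mulrDl. Qed.

Lemma meanZ (c : R) g : mean (fun e => c * g e) = c * mean g.
Proof. by rewrite /mean -mulr_sumr mulrA. Qed.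

Lemma meanB g h : mean (fun e => g e - h e) = mean g - mean h.
Proof. by rewrite /mean big_split sumrN mulrBl. Qed.

Lemma mean_sum (J : finType) (P : pred J) (G : J -> {ffun I -> bool} -> R) :
  mean (fun e => \sum_(j | P j) G j e) = \sum_(j | P j) mean (G j).
Proof. by rewrite /mean exchange_big/= mulr_suml. Qed.

Lemma mean_cst (c : R) : mean (fun=> c) = c.
Proof.
rewrite /mean sumr_const -[c *+ _]mulr_natr.
by rewrite mulfK// gt_eqF ?card_signs_gt0.
Qed.

Lemma mean_ge0 g : (forall e, 0 <= g e) -> 0 <= mean g.
Proof. by move=> g0; rewrite -(mean_cst 0); exact: ler_mean. Qed.

Lemma ler_norm_mean g : `|mean g| <= mean (fun e => `|g e|).
Proof.
rewrite normrM normfV (gtr0_norm card_signs_gt0).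
by rewrite ler_pM2r ?invr_gt0 ?card_signs_gt0// ler_norm_sum.
Qed.

(** The variance of |g| is nonnegative. *)
Lemma mean_norm_le_sqrt g : mean (fun e => `|g e|) <= Num.sqrt (mean (fun e => g e ^+ 2)).
Proof.
set m := mean (fun e => `|g e|).
have m0 : 0 <= m by apply: mean_ge0.
rewrite -[m]ger0_norm// -sqrtr_sqr.
apply: ler_wsqrtr.
have : 0 <= mean (fun e => (`|g e| - m) ^+ 2) by apply: mean_ge0 => e; exact: sqr_ge0.
have -> : mean (fun e => (`|g e| - m) ^+ 2) =
    mean (fun e => (g e ^+ 2 - 2 * m * `|g e|) + m ^+ 2).
  by apply: eq_mean => e; rewrite -[in RHS](real_normK (num_real (g e))); ring.
rewrite meanD meanB meanZ mean_cst -/m => H.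
rewrite -subr_ge0; apply: (le_trans H).
by rewrite le_eqVlt; apply/orP; left; apply/eqP; ring.
Qed.

Definition flip (i : I) e : {ffun I -> bool} := [ffun j => (j == i) (+) e j].

Lemma flipK i : involutive (flip i).
Proof. by move=> e; apply/ffunP => j; rewrite !ffunE addbA addbb. Qed.

Lemma mean_flip i g : mean (fun e => g (flip i e)) = mean g.
Proof.
by rewrite /mean [in RHS](reindex_inj (inv_inj (flipK i))).
Qed.

(** The Walsh characters. When I indexes the primes, [chi A] is the value of f at the product of the
    primes in A. *)
Definition chi A e : R := \prod_(i in A) (-1) ^+ e i.

Lemma chi0 e : chi finset.set0 e = 1.
Proof. by rewrite /chi big_set0. Qed.

Lemma chi_flip i A e : chi A (flip i e) = (-1) ^+ (i \in A) * chi A e.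
Proof.
rewrite /chi; under eq_bigr do rewrite ffunE signr_addb.
rewrite big_split/=; congr (_ * _).
case: (boolP (i \in A)) => iA.
  rewrite (bigD1 i)//= eqxx big1 ?mulr1// => j /andP[_ /negbTE ->]//.
rewrite big1// => j jA; case: eqP => // ji; by rewrite -ji jA in iA.
Qed.

Lemma mean_chi A : mean (chi A) = (A == finset.set0)%:R.
Proof.
have [->|/set0Pn[i iA]] := eqVneq A finset.set0.
  by rewrite (eq_mean chi0) mean_cst.
have : mean (chi A) = - mean (chi A).
  rewrite -[LHS](mean_flip i) -mulN1r -meanZ; apply: eq_mean => e.
  by rewrite chi_flip iA expr1.
move/eqP; rewrite -addr_eq0 -mulr2n mulrn_eq0/= => /eqP ->//.
Qed.

Lemma chiM A B e : chi A e * chi B e = chi ((A :\: B) :|: (B :\: A)) e.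
Proof.
rewrite /chi [X in X * _]big_mkcond [X in _ * X]big_mkcond [RHS]big_mkcond -big_split/=.
apply: eq_bigr => i _.
rewrite !inE; case: (i \in A); case: (i \in B); rewrite ?mulr1 ?mul1r//=.
by rewrite -signr_addb addbb.
Qed.

Definition indep i g := forall e, g (flip i e) = g e.

Lemma chi_indep i A : i \notin A -> indep i (chi A).
Proof. by move=> /negbTE iA e; rewrite chi_flip iA mul1r. Qed.

(* Lindeberg replacement: the random signs of [l] are traded, one at a time,
   for heat flow run for the squared coefficient. *)
Lemma mean_heat_clt (l : seq I) (z c : {ffun I -> bool} -> R)
    (a : I -> {ffun I -> bool} -> R) (s : R) :
  0 < s -> uniq l -> (forall e, s <= c e) ->
  {in l, forall i, indep i z} -> {in l, forall i, indep i c} ->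
  {in l &, forall i j, indep i (a j)} ->
  `|mean (fun e => heat (c e) (z e - \sum_(i <- l) (-1) ^+ e i * a i e))
    - mean (fun e => heat (c e + \sum_(i <- l) a i e ^+ 2) (z e))|
  <= 4 / (s * Num.sqrt s) * mean (fun e => \sum_(i <- l) `|a i e| ^+ 3).
Proof.
move=> s0; elim: l z => [|i l IH] z.
  move=> _ _ _ _ _.
  rewrite (eq_mean (h := fun e => heat (c e) (z e))); last first.
    by move=> e; rewrite big_nil subr0.
  rewrite [X in _ - X](eq_mean (h := fun e => heat (c e) (z e))); last first.
    by move=> e; rewrite big_nil addr0.
  rewrite subrr normr0 mulr_ge0//; last first.
    by rewrite mean_ge0// => e; rewrite big_nil.
  by rewrite divr_ge0// mulr_ge0 ?sqrtr_ge0 ?ltW.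
rewrite cons_uniq => /andP[il ul] sc zi ci ai.
have in_l j : j \in l -> j \in i :: l by rewrite inE orbC => ->.
have il' : i \in i :: l by rewrite inE eqxx.
(* The sign of [i] is first kept inside the threshold while the induction hypothesis trades the
   tail. It is traded last, at the variance [C], which is at least s and does not depend on that
   sign. *)
pose z' e := z e - (-1) ^+ e i * a i e.
pose C e := c e + \sum_(j <- l) a j e ^+ 2.
have Cs e : s <= C e.
  by rewrite ler_wpDr ?sc// sumr_ge0// => j _; exact: sqr_ge0.
have := IH z' ul sc.
have ih1 : {in l, forall j, indep j z'}.
  move=> j jl e; rewrite /z' (zi j (in_l _ jl)) (ai j i (in_l _ jl) il') ffunE.
  have -> : (i == j) = false by apply/eqP => ij; rewrite ij jl in il.
  by [].
move=> /(_ ih1 (fun j jl => ci j (in_l _ jl))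
  (fun j k jl kl => ai j k (in_l _ jl) (in_l _ kl))).
rewrite (eq_mean (h := fun e =>
  heat (c e) (z e - \sum_(j <- i :: l) (-1) ^+ e j * a j e))); last first.
  by move=> e; rewrite /z' big_cons opprD addrA.
rewrite -/C => H1.
have Ci : indep i C.
  move=> e; rewrite /C ci//; congr (_ + _); rewrite !big_seq.
  by apply: eq_bigr => j jl; rewrite (ai i j il' (in_l _ jl)).
(* Only the explicit sign changes under [flip i], so averaging over e and [flip i e] produces the
   symmetric mean of [heat_step]. *)
have H2 : mean (fun e => heat (C e) (z' e)) =
    mean (fun e => (heat (C e) (z e + a i e) + heat (C e) (z e - a i e)) / 2).
  have H3 : mean (fun e => heat (C e) (z' e)) =
      mean (fun e => heat (C e) (z e + (-1) ^+ e i * a i e)).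
    rewrite -(mean_flip i); apply: eq_mean => e.
    rewrite Ci /z' (zi i il') (ai i i il' il') ffunE eqxx/= -[~~ _]/(true (+) e i) signr_addb.
    by rewrite expr1 mulN1r mulNr opprK.
  suff : 2 * mean (fun e => heat (C e) (z' e)) =
      2 * mean (fun e => (heat (C e) (z e + a i e) + heat (C e) (z e - a i e)) / 2).
    by move/(mulfI _); apply; rewrite pnatr_eq0.
  rewrite -[RHS]meanZ mulr_natl mulr2n [X in X + _ = _]H3 -meanD.
  apply: eq_mean => e; rewrite /z' mulrCA divff ?pnatr_eq0// mulr1.
  by case: (e i); rewrite ?expr0 ?expr1 ?mul1r ?mulN1r ?opprK// addrC.
have H4 : `|mean (fun e => heat (C e) (z' e)) - mean (fun e => heat (C e + a i e ^+ 2) (z e))|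
   <= 4 / (s * Num.sqrt s) * mean (fun e => `|a i e| ^+ 3).
  rewrite H2 -meanB; apply: (le_trans (ler_norm_mean _)).
  rewrite -meanZ; apply: ler_mean => e.
  have C0 : 0 < C e by rewrite (lt_le_trans s0).
  apply: (le_trans (heat_step _ _ C0)).
  rewrite mulrAC ler_wpM2r ?exprn_ge0// ler_wpM2l//.
  have sC : s * Num.sqrt s <= C e * Num.sqrt (C e).
    by apply: ler_pM; rewrite ?sqrtr_ge0 ?Cs ?ler_wsqrtr// ltW.
  by rewrite lef_pV2// posrE mulr_gt0// sqrtr_gt0.
rewrite [X in _ - X](eq_mean (h := fun e => heat (C e + a i e ^+ 2) (z e))); last first.
  by move=> e; rewrite /C big_cons [a i e ^+ 2 + _]addrC addrA.
rewrite [X in _ * X](eq_mean (h := fun e => \sum_(j <- l) `|a j e| ^+ 3 + `|a i e| ^+ 3)); last first.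
  by move=> e; rewrite big_cons addrC.
rewrite meanD mulrDr.
apply: le_trans (lerD H1 H4).
by apply: le_trans (ler_normD _ _); rewrite addrA subrK.
Qed.

End RandomSigns.

(** * Removing the Gaussian smoothing *)

(** With N standard normal and independent of S, the mean of [heat s (y - S)] is the probability
    that S + sqrt s * N <= y. For small s the added noise rarely exceeds h, so the distribution
    function of S at x lies between the smoothed ones at x - h and x + h, up to h. *)
Lemma cvg_cdf_of_heat (R : realType) (I : nat -> finType)
    (S : forall n, {ffun I n -> bool} -> R) :
  (forall s y : R, 0 < s ->
    (fun n => mean (fun e => heat s (y - S n e))) @ \oo --> heat (s + 1) y) ->
  forall x : R,
    (fun n => #|[set e | S n e <= x]%SET|%:R / #|{ffun I n -> bool}|%:R : R) @ \oo
      --> ncdf x.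
Proof.
move=> H x; apply/cvgrPdist_le => d d0.
(* Four errors of size h add up: the smoothing, the limit in n, the change of variance from s + 1 to
   1, and the shift of x by h. *)
pose h : R := d / 8.
have h0 : 0 < h by rewrite divr_gt0.
have [y0 hy0] := ncdf_tailR h0.
have [y1 hy1] := ncdf_tailL h0.
pose M := 1 + `|y0| + `|y1|.
have M0 : 0 < M by rewrite /M; have := normr_ge0 y0; have := normr_ge0 y1; lra.
(* The bounds serve, in this order, the tails of N(0, t^2) outside [- h, h], the estimate t^2 <= t,
   and the distance of [heat (s + 1)] from [ncdf] near x. *)
pose t := Num.min (h / M) (Num.min 1 (h / (`|x| + h + 1))).
have x1 : 0 < `|x| + h + 1 by have := normr_ge0 x; lra.
have t0 : 0 < t by rewrite !lt_min ltr01 !divr_gt0.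
have t1 : t <= h / M by rewrite ge_min lexx.
have t2 : t <= 1 by rewrite !ge_min lexx orbT.
have t3 : t <= h / (`|x| + h + 1) by rewrite !ge_min lexx !orbT.
pose s := t ^+ 2.
have s0 : 0 < s by rewrite exprn_gt0.
have ss : Num.sqrt s = t by rewrite sqrtr_sqr gtr0_norm.
have ht : M <= h / t by rewrite ler_pdivlMr// mulrC -ler_pdivlMr.
have hR : 1 - h <= heat s h.
  apply: (le_trans hy0); rewrite /heat ss; apply: ncdf_homo.
  apply: (le_trans _ ht); rewrite /M; have := ler_norm y0; have := normr_ge0 y1; lra.
have hL : heat s (- h) <= h.
  apply: (le_trans _ hy1); rewrite /heat ss; apply: ncdf_homo.
  rewrite mulNr lerNl; apply: (le_trans _ ht).
  rewrite /M; have := ler_norm (- y1); have := normr_ge0 y0; rewrite normrN; lra.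
have hs u : `|u| <= `|x| + h -> `|heat (s + 1) u - ncdf u| <= h.
  move=> ux; have -> : ncdf u = heat 1 u by rewrite /heat sqrtr1 divr1.
  have := @heat_lip_var R 1 (s + 1) 1 u ltr01.
  rewrite lexx ler_wpDl ?(ltW s0)// => /(_ isT isT).
  rewrite sqrtr1 mulr1 divr1 addrK (gtr0_norm s0) => /le_trans; apply.
  have : s <= h / (`|x| + h + 1).
    by rewrite (le_trans _ t3)// /s expr2 ler_piMl// ltW.
  rewrite ler_pdivlMr// => hh.
  have : `|u| * s <= (`|x| + h) * s by rewrite ler_wpM2r// ltW.
  have : 0 <= s by exact: ltW.
  move: hh; lra.
have := H s (x + h) s0; move/cvgrPdist_le => /(_ _ h0) HR.
have := H s (x - h) s0; move/cvgrPdist_le => /(_ _ h0) HL.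
near=> n.
have HR' : `|heat (s + 1) (x + h) - mean (fun e => heat s (x + h - S n e))| <= h.
  by near: n.
have HL' : `|heat (s + 1) (x - h) - mean (fun e => heat s (x - h - S n e))| <= h.
  by near: n.
have -> : #|[set e | S n e <= x]%SET|%:R / #|{ffun I n -> bool}|%:R =
    mean (fun e : {ffun I n -> bool} => (S n e <= x)%R%:R) :> R.
  rewrite /mean; congr (_ / _); rewrite -sum1_card natr_sum big_mkcond/=.
  by apply: eq_bigr => e _; rewrite inE; case: ifP.
set P := mean _.
have PU : P <= mean (fun e => heat s (x + h - S n e)) + h.
  rewrite -[X in _ + X](@mean_cst R (I n)) -meanD; apply: ler_mean => e.
  have := heat_ge0 s (x + h - S n e).
  case: (leP (S n e) x) => [Sx|_]; last by move: h0; rewrite mulr0n; lra.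
  have : heat s h <= heat s (x + h - S n e) by apply: heat_homo; lra.
  by move: hR; rewrite mulr1n; lra.
have PL : mean (fun e => heat s (x - h - S n e)) - h <= P.
  rewrite -[X in _ - X](@mean_cst R (I n)) -meanB; apply: ler_mean => e.
  have := heat_le1 s (x - h - S n e).
  case: (leP (S n e) x) => [Sx|xS]; first by move: h0; rewrite mulr1n; lra.
  have : heat s (x - h - S n e) <= heat s (- h) by apply: heat_homo; lra.
  by move: hL; rewrite mulr0n; lra.
have hxp : `|x + h| <= `|x| + h.
  by rewrite (le_trans (ler_normD _ _))// (gtr0_norm h0).
have hxm : `|x - h| <= `|x| + h.
  by rewrite (le_trans (ler_normB _ _))// (gtr0_norm h0).
have {hxp} := hs _ hxp; have {hxm} := hs _ hxm.
have := ncdf_lip (x + h) x; have := ncdf_lip (x - h) x.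
have -> : x - h - x = - h by ring.
have -> : x + h - x = h by ring.
rewrite normrN (gtr0_norm h0).
have hd : d = 8 * h by rewrite /h; field.
move: HR' HL' PU PL; rewrite !ler_norml hd.
move: (heat _ _) (heat _ _) (ncdf _) (ncdf _) (ncdf _) P (mean _) (mean _).
move=> *; apply/andP; split; lra.
Unshelve. all: by end_near.
Qed.

(** * Finite sums: injections, Cauchy-Schwarz, double counting *)

Lemma ler_sum_inj (R : realType) (T U : finType) (P : pred T) (Q : pred U)
    (h : T -> U) (f : U -> R) :
  (forall x y, P x -> P y -> h x = h y -> x = y) -> (forall x, P x -> Q (h x)) ->
  (forall y, Q y -> 0 <= f y) ->
  \sum_(x | P x) f (h x) <= \sum_(y | Q y) f y.
Proof.
move=> hi PQ f0.
have -> : \sum_(x | P x) f (h x) = \sum_(y in [set h x | x in P]%SET) f y.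
  by rewrite big_imset// => x y; exact: hi.
rewrite [leRHS](bigID (fun y => y \in [set h x | x in P]%SET))/=.
rewrite -[leLHS]addr0 lerD//; last by apply: sumr_ge0 => y /andP[/f0].
rewrite le_eqVlt; apply/orP; left; apply/eqP; apply: eq_bigl => y.
rewrite [RHS]andbC; case: imsetP => //= -[x xP ->]; exact/esym/PQ.
Qed.

Lemma sqr_sum_le_card (R : realType) (T : finType) (P : pred T) (f : T -> R) :
  (\sum_(i | P i) f i) ^+ 2 <= #|P|%:R * \sum_(i | P i) f i ^+ 2.
Proof.
have H : (\sum_(i | P i) f i) ^+ 2 =
    \sum_(i | P i) \sum_(j | P j) f i * f j.
  by rewrite expr2 mulr_suml; apply: eq_bigr => i _; rewrite mulr_sumr.
have H1 : #|P|%:R * \sum_(i | P i) f i ^+ 2 =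
    \sum_(i | P i) \sum_(j | P j) f i ^+ 2.
  rewrite exchange_big/= sumr_const mulr_natl.
  by congr (_ *+ _).
have H2 : #|P|%:R * \sum_(i | P i) f i ^+ 2 =
    \sum_(i | P i) \sum_(j | P j) f j ^+ 2.
  by rewrite H1 exchange_big.
suff : (\sum_(i | P i) f i) ^+ 2 *+ 2 <=
    (#|P|%:R * \sum_(i | P i) f i ^+ 2) *+ 2 by rewrite lerMn2r.
rewrite mulr2n [leRHS]mulr2n {1}H1 H2 H -!big_split/=; apply: ler_sum => i _.
rewrite -!big_split/=; apply: ler_sum => j _.
by rewrite -subr_ge0 (_ : _ - _ = (f i - f j) ^+ 2) ?sqr_ge0//; ring.
Qed.

Section DoubleCounting.
Variables (R : realType) (I : finType).

(** Both sides run over sets with one marked element, removed on the right. Every induction on the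
    number of factors below marks a factor in this way. *)
Lemma sum_setU1 (F : {set I} -> I -> R) j :
  \sum_(A : {set I} | #|A| == j.+1) \sum_(i in A) F (A :\ i)%SET i =
  \sum_(G : {set I} | #|G| == j) \sum_(i | i \notin G) F G i.
Proof.
rewrite pair_big_dep/= [RHS]pair_big_dep/=.
rewrite (reindex_onto (fun x : {set I} * I => ((x.2 |: x.1)%SET, x.2))
  (fun x : {set I} * I => ((x.1 :\ x.2)%SET, x.2)))/=; last first.
  by case=> A i /= /andP[_ iA]; rewrite finset.setD1K.
apply: eq_big => [[G i]/=|[G i]/= /andP[_ /eqP[->]]//].
rewrite setU11 andbT cardsU1 xpair_eqE eqxx andbT.
have [iG|iG] := boolP (i \in G).
  rewrite andbF; apply/negbTE; rewrite negb_and; apply/orP; right.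
  apply/eqP => h; have : i \in ((i |: G) :\ i)%SET by rewrite h.
  by rewrite !inE eqxx.
by rewrite setU1K// eqxx !andbT add1n eqSS.
Qed.

End DoubleCounting.

Lemma sqr_le_half (R : realType) (th : R) :
  0 <= th -> th <= 32^-1 -> 256 * th ^+ 2 <= 2^-1.
Proof. by move=> th0 th1; have := ler_pM th0 th0 th1 th1; rewrite -expr2; lra. Qed.

(** * Weighted sets of primes: elementary symmetric sums and counts by degree *)

Section Weights.
Local Open Scope set_scope.
Local Open Scope ring_scope.
Variables (R : realType) (I : finType) (d : I -> nat) (q n : nat).
Hypothesis q2 : (2 <= q)%N.
Hypothesis d1 : forall i, (1 <= d i)%N.

Notation cnt D := #|[set i | d i == D]%SET|.
Hypothesis cnt_le : forall D, (D * cnt D <= q ^ D)%N.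
Hypothesis cnt_ge : forall D, (1 <= D <= n)%N -> (q ^ D <= 2 * D * cnt D)%N.

Implicit Types (A B G X Y : {set I}) (i : I) (r D m : nat).

Notation p := (q%:R^-1 : R).
Notation L := (\sum_i p ^+ d i).

Definition deg A : nat := (\sum_(i in A) d i)%N.
Definition wt A : R := p ^+ deg A.
Definition elsym j : R := \sum_(A : {set I} | #|A| == j) wt A.
(** The number of products of r distinct primes of total degree D, divided by the number q^D of
    monic polynomials of that degree. *)
Definition rho r D : R := \sum_(A : {set I} | (#|A| == r) && (deg A == D)) wt A.

Lemma q_gt0 : 0 < q%:R :> R. Proof. by rewrite ltr0n; case: (q) q2. Qed.

Lemma p_gt0 : 0 < p. Proof. by rewrite invr_gt0 q_gt0. Qed.

Lemma p_le_half : p <= 2^-1.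
Proof. by rewrite lef_pV2 ?posrE ?q_gt0// ler_nat. Qed.

Lemma wt_gt0 A : 0 < wt A. Proof. by rewrite exprn_gt0// p_gt0. Qed.
Lemma wt_ge0 A : 0 <= wt A. Proof. exact/ltW/wt_gt0. Qed.
Lemma elsym_ge0 j : 0 <= elsym j. Proof. by apply: sumr_ge0 => A _; exact: wt_ge0. Qed.
Lemma rho_ge0 r D : 0 <= rho r D. Proof. by apply: sumr_ge0 => A _; exact: wt_ge0. Qed.

Lemma degU A B : [disjoint A & B]%B -> deg (A :|: B) = (deg A + deg B)%N.
Proof.
by move=> AB; rewrite /deg -bigU//; apply: eq_bigl => i; rewrite !inE.
Qed.

Lemma degD1 A i : i \in A -> deg A = (d i + deg (A :\ i)%SET)%N.
Proof. by move=> iA; rewrite /deg (big_setD1 i). Qed.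

Lemma wtU A B : [disjoint A & B]%B -> wt (A :|: B) = wt A * wt B.
Proof. by move=> AB; rewrite /wt degU// exprD. Qed.

Lemma wtD1 A i : i \in A -> wt A = p ^+ d i * wt (A :\ i)%SET.
Proof. by move=> iA; rewrite /wt (degD1 iA) exprD. Qed.

Lemma qpE (a b : nat) : (b <= a)%N -> q%:R ^+ a * p ^+ b = q%:R ^+ (a - b).
Proof. by move=> ba; rewrite expfB_cond// ?exprVn//; rewrite gt_eqF ?q_gt0. Qed.

Lemma card_le_deg A : (#|A| <= deg A)%N.
Proof. by rewrite -sum1_card; apply: leq_sum. Qed.

Lemma sum_deg_eq D (P : pred I) :
  \sum_(i | P i && (d i == D)) (d i)%:R * p ^+ d i <= 1.
Proof.
apply: (@le_trans _ _ (\sum_(i | d i == D) D%:R * p ^+ D)).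
  rewrite [leRHS](bigID P)/= -[leLHS]addr0 lerD//.
    rewrite le_eqVlt; apply/orP; left; apply/eqP.
    by rewrite [RHS](eq_bigl _ _ (fun i => andbC _ _)); apply: eq_bigr => i /andP[_ /eqP ->].
  by apply: sumr_ge0 => i _; rewrite mulr_ge0// exprn_ge0// ltW ?p_gt0.
rewrite sumr_const -cardsE -[_ *+ _]mulr_natr mulrAC exprVn.
rewrite ler_pdivrMr ?exprn_gt0 ?q_gt0// mul1r -natrM -natrX ler_nat.
exact: cnt_le.
Qed.

Lemma elsym_recr j : j.+1%:R * elsym j.+1 =
  \sum_(G : {set I} | #|G| == j) wt G * \sum_(i | i \notin G) p ^+ d i.
Proof.
under eq_bigr do rewrite mulr_sumr.
rewrite -(sum_setU1 (fun G i => wt G * p ^+ d i)) mulr_sumr.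
apply: eq_bigr => A /eqP Aj.
under eq_bigr => i iA do rewrite mulrC -wtD1//.
by rewrite sumr_const Aj mulr_natl.
Qed.

(** A set of j indices can be extended by any index outside it. The excluded ones weigh at most 1/2
    each, so together at most j / 2 <= L / 2. *)
Lemma elsym_ratio j : j.+1%:R <= L -> L * elsym j <= 2 * j.+1%:R * elsym j.+1.
Proof.
move=> jL; rewrite -mulrA elsym_recr /elsym !mulr_sumr; apply: ler_sum => G /eqP Gj.
rewrite mulrCA mulrC ler_wpM2l ?wt_ge0//.
rewrite [X in X <= _](bigID (mem G))/=.
have : \sum_(i in G) p ^+ d i <= j%:R / 2.
  apply: (@le_trans _ _ (\sum_(i in G) 2^-1)).
    apply: ler_sum => i _; apply: le_trans p_le_half.
    case: (d i) (d1 i) => // k _; rewrite exprS ler_piMr ?(ltW p_gt0)//.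
    rewrite exprn_ile1// ?(ltW p_gt0)//.
    by rewrite (le_trans p_le_half)// invf_le1// ler1n.
  by rewrite sumr_const Gj mulr_natl.
move: jL; rewrite (bigID (mem G))/= -natr1.
move: (\sum_(i in G) _) (\sum_(i | i \notin G) _) => a b; lra.
Qed.

Lemma elsym_ratio_iter (th : R) (k r : nat) :
  0 <= th <= 1 -> 0 < L -> k%:R <= th * L -> (r <= k)%N ->
  elsym (k - r)%N <= (2 * th) ^+ r * elsym k.
Proof.
move=> /andP[th0 th1] L0 kL; elim: r => [|r IH] rk; first by rewrite subn0 mul1r.
have rk' := ltnW rk.
apply: le_trans (_ : 2 * th * elsym (k - r)%N <= _); last first.
  by rewrite exprS -[leRHS]mulrA ler_wpM2l ?mulr_ge0// IH.
have jk : (k - r.+1).+1 = (k - r)%N by rewrite subnSK.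
have h : (k - r)%N%:R <= th * L.
  by apply: le_trans kL; rewrite ler_nat leq_subr.
have := @elsym_ratio (k - r.+1)%N; rewrite jk => H.
have {}H := H (le_trans h (ler_piMl (ltW L0) th1)).
rewrite -(ler_pM2l L0); apply: (le_trans H).
rewrite mulrA ler_wpM2r ?elsym_ge0//.
by rewrite mulrCA ler_wpM2l// mulrC.
Qed.

(** Mark a factor and weight it by its degree: the weights of the factors of a product add up to D.
    Given the cofactor G, the marked factor has degree D - deg G, and [sum_deg_eq] bounds its total
    contribution by 1. *)
Lemma rho_rec r D : D%:R * rho r.+1 D <= \sum_(D' < D) rho r D'.
Proof.
have -> : D%:R * rho r.+1 D = \sum_(A : {set I} | #|A| == r.+1)
    \sum_(i in A) (if deg (A :\ i)%SET + d i == D then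
       (d i)%:R * p ^+ d i * wt (A :\ i)%SET else 0).
  rewrite /rho big_mkcondr mulr_sumr; apply: eq_bigr => A _.
  case: eqP => [AD|AD]; last first.
    rewrite mulr0 big1// => i iA; case: eqP => // h; case: AD.
    by rewrite (degD1 iA) addnC.
  rewrite -AD [X in X%:R]/deg natr_sum mulr_suml; apply: eq_bigr => i iA.
  by rewrite [deg A](degD1 iA) addnC eqxx -mulrA -wtD1.
rewrite (sum_setU1 (fun G i => if deg G + d i == D then
  (d i)%:R * p ^+ d i * wt G else 0)).
have -> : \sum_(D' < D) rho r D' =
    \sum_(G : {set I} | (#|G| == r) && (deg G < D)%N) wt G.
  rewrite /rho (exchange_big_dep (fun G : {set I} => (#|G| == r) && (deg G < D)%N))/=; last first.
    by move=> D' G _ /andP[-> /eqP ->]/=.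
  apply: eq_bigr => G /andP[Gr GD]; rewrite (big_pred1 (Ordinal GD))// => D'.
  by rewrite Gr/= -val_eqE/= eq_sym.
rewrite [leRHS]big_mkcondr/=; apply: ler_sum => G _.
case: ifPn => [GD|]; last first.
  rewrite -leqNgt => DG; rewrite big1// => i _; case: eqP => // h.
  by move: DG; rewrite -h leqNgt -[X in (X < _)%N]addn0 ltn_add2l d1.
have -> : \sum_(i | i \notin G) (if deg G + d i == D then
      (d i)%:R * p ^+ d i * wt G else 0) =
    (\sum_(i | (i \notin G) && (d i == D - deg G)%N) (d i)%:R * p ^+ d i) * wt G.
  rewrite mulr_suml [RHS]big_mkcondr/=; apply: eq_bigr => i _.
  by rewrite -(eqn_add2l (deg G)) subnKC// ltnW.
by rewrite ler_piMl ?wt_ge0// sum_deg_eq.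
Qed.

Lemma rho0 D : rho 0 D = (D == 0)%:R.
Proof.
rewrite /rho; case: D => [|D].
  rewrite (big_pred1 finset.set0) ?/wt/deg ?big_set0// => A.
  by rewrite /= cards_eq0; case: eqP => // ->; rewrite /deg big_set0.
rewrite big_pred0// => A; rewrite cards_eq0; case: eqP => // ->.
by rewrite /deg big_set0.
Qed.

Lemma rhoS0 r : rho r.+1 0 = 0.
Proof.
rewrite /rho big_pred0// => A; apply/negbTE; rewrite negb_and.
case: (eqVneq #|A| r.+1) => //= Ar.
by have := card_le_deg A; rewrite Ar; case: (deg A).
Qed.

Lemma rho_le1 r D : rho r D <= 1.
Proof.
elim: r D => [|r IH] D; first by rewrite rho0 lern1 leq_b1.
case: D => [|D]; first by rewrite rhoS0.
have := rho_rec r D.+1; have : \sum_(D' < D.+1) rho r D' <= D.+1%:R.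
  apply: (@le_trans _ _ (\sum_(D' < D.+1) 1)); first by apply: ler_sum.
  by rewrite sumr_const card_ord.
move=> h1 h2; have := le_trans h2 h1.
by rewrite -[leRHS]mulr1 ler_pM2l// ltr0n.
Qed.

(* [quarter D] is the coefficient of [x ^ D] in [(1 - x) ^ (- 1/4)], and
   [quarter_sum m] the sum of its first [m + 1] values. *)
Definition quarter_sum m : R := \prod_(j < m) (1 + (4 * j.+1%:R)^-1).
Definition quarter D : R :=
  if D is m.+1 then quarter_sum m / (4 * m.+1%:R) else 1.

Lemma quarter_sumS m :
  quarter_sum m.+1 = quarter_sum m * (1 + (4 * m.+1%:R)^-1).
Proof. by rewrite /quarter_sum big_ord_recr. Qed.

Lemma sum_quarter m : \sum_(D < m.+1) quarter D = quarter_sum m.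
Proof.
elim: m => [|m IH]; first by rewrite big_ord1 /quarter_sum big_ord0.
by rewrite big_ord_recr/= IH quarter_sumS mulrDr mulr1.
Qed.

Lemma quarter_sum_ge0 m : 0 <= quarter_sum m.
Proof.
apply: prodr_ge0 => j _; rewrite addr_ge0// invr_ge0 mulr_ge0//.
Qed.

Lemma quarter_ge0 m : 0 <= quarter m.
Proof.
case: m => //= m; by rewrite divr_ge0 ?quarter_sum_ge0 ?mulr_ge0.
Qed.

Lemma sum_sqr_quarter m : \sum_(D < m) quarter D ^+ 2 <= 2.
Proof.
case: m => [|m]; first by rewrite big_ord0.
(* The added term bounds the remaining tail: with it the left side decreases in m, starting from 2
   at m = 0. *)
suff : \sum_(D < m.+1) quarter D ^+ 2 + quarter_sum m ^+ 2 / m.+1%:R <= 2.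
  by apply: le_trans; rewrite lerDl divr_ge0// sqr_ge0.
elim: m => [|m IH].
  by rewrite big_ord1 /quarter_sum big_ord0 !expr1n divr1.
apply: le_trans IH; rewrite big_ord_recr/= -addrA lerD2l quarter_sumS.
set T := quarter_sum m.
have x0 : 0 < m.+1%:R :> R by rewrite ltr0n.
have x1 : 1 <= m.+1%:R :> R by rewrite ler1n.
rewrite -[m.+2%:R]natr1; move: (m.+1%:R) x0 x1 => x x0 x1.
rewrite -subr_ge0.
have -> : T ^+ 2 / x - ((T / (4 * x)) ^+ 2 + (T * (1 + (4 * x)^-1)) ^+ 2 / (x + 1))
  = T ^+ 2 * ((7 * x - 2) / (16 * x ^+ 2 * (x + 1))).
  by field; lra.
rewrite mulr_ge0 ?sqr_ge0// divr_ge0; [by []|lra|].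
by rewrite mulr_ge0 ?mulr_ge0 ?sqr_ge0//; lra.
Qed.

(** For D > 0, [D%:R * quarter D] is one quarter of the sum of the earlier values, so the right side
    satisfies the recursion of [rho_rec] with equality. *)
Lemma rho_le_quarter r D : rho r D <= 4 ^+ r * quarter D.
Proof.
elim: r D => [|r IH] D.
  rewrite rho0 mul1r; case: D => // D; exact: quarter_ge0.
case: D => [|D]; first by rewrite rhoS0 mulr1 exprn_ge0.
rewrite -(@ler_pM2l _ D.+1%:R) ?ltr0n//; apply: (le_trans (rho_rec _ _)).
apply: (@le_trans _ _ (\sum_(D' < D.+1) 4 ^+ r * quarter D')).
  by apply: ler_sum.
rewrite -mulr_sumr sum_quarter/= le_eqVlt; apply/orP; left; apply/eqP.
by rewrite exprS; field.
Qed.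

Lemma sum_sqr_rho r m : \sum_(D < m) rho r D ^+ 2 <= 2 * 16 ^+ r.
Proof.
apply: (@le_trans _ _ (\sum_(D < m) 16 ^+ r * quarter D ^+ 2)).
  apply: ler_sum => D _.
  have -> : 16 ^+ r * quarter D ^+ 2 = (4 ^+ r * quarter D) ^+ 2.
    by rewrite exprMn -exprM mulnC exprM (_ : 16 = 4 ^+ 2 :> R)//; ring.
  rewrite ler_pXn2r// ?nnegrE ?rho_ge0 ?rho_le_quarter//.
  by rewrite mulr_ge0 ?exprn_ge0 ?quarter_ge0.
by rewrite -mulr_sumr mulrC ler_wpM2r ?exprn_ge0// sum_sqr_quarter.
Qed.

Lemma sum_balanced_pairs r :
  \sum_(x : {set I} * {set I} | [&& #|x.1| == r, #|x.2| == r & deg x.1 == deg x.2])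
    wt x.1 * wt x.2 <= 2 * 16 ^+ r.
Proof.
pose M := (deg [set: I]).+1.
have degM A : (deg A < M)%N.
  rewrite ltnS /deg [leqRHS](bigID (mem A))/=.
  rewrite [X in (_ <= X + _)%N](eq_bigl (mem A)) ?leq_addr// => i.
  by rewrite inE.
apply: le_trans (sum_sqr_rho r M).
rewrite le_eqVlt; apply/orP; left; apply/eqP.
have -> : \sum_(D < M) rho r D ^+ 2 = \sum_(D < M) \sum_(x : {set I} * {set I} |
   ((#|x.1| == r) && (deg x.1 == D)) && ((#|x.2| == r) && (deg x.2 == D)))
    wt x.1 * wt x.2.
  apply: eq_bigr => D _; rewrite expr2 /rho big_distrlr/= pair_big/=.
  by [].
rewrite (exchange_big_dep (fun x : {set I} * {set I} =>
  [&& #|x.1| == r, #|x.2| == r & deg x.1 == deg x.2]))/=; last first.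
  by move=> D [A B] _ /= /andP[/andP[-> /eqP ->] /andP[-> /eqP ->]] /=.
apply: eq_bigr => -[A B] /= /and3P[Ar Br /eqP AB].
rewrite (big_pred1 (Ordinal (degM A)))// => D.
by rewrite /= Ar Br -AB/= andbb -val_eqE/= eq_sym.
Qed.

(** * Products with and without a big factor *)

Variable k : nat.
Hypothesis n0 : (0 < n)%N.
Hypothesis dn : forall i, (d i <= n)%N.

(** From here on [k] counts the factors other than a distinguished one, so it is one less than the k
    of the theorem. *)
Definition target : pred {set I} := fun A => (#|A| == k.+1) && (deg A == n).
(* An index set of total degree [n] contains at most one big index. *)
Definition big i := (3 * n <= 4 * d i)%N.
Definition nbig A : nat := (\sum_(i in A) big i)%N.
Definition Ntot : R := \sum_(A | target A) 1.
Definition Nbig : R := \sum_(A | target A) (nbig A)%:R.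
(** The cofactors that leave a degree below 3n/4, too little for a big index. *)
Definition Mtail : R := \sum_(G : {set I} | (#|G| == k) && (n < 4 * deg G)%N) wt G.

Lemma nbig_le1 A : target A -> (nbig A <= 1)%N.
Proof.
move=> /andP[_ /eqP dA].
suff : (nbig A * (3 * n) <= 4 * n)%N by move: n0; nia.
rewrite -{2}dA /nbig /deg big_distrl big_distrr/=; apply: leq_sum => i _.
by rewrite /big; case: (boolP (3 * n <= 4 * d i)%N) => h; rewrite ?mul1n ?mul0n.
Qed.

Lemma big_notin i G : big i -> (deg G + d i == n)%N -> i \notin G.
Proof.
move=> bi /eqP h; apply/negP => iG; move: h bi; rewrite (degD1 iG) /big.
by move: n0 (deg _) => ? ?; lia.
Qed.

Lemma sum_target (f : {set I} -> R) :
  \sum_(A | target A) (nbig A)%:R * f A =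
  \sum_(i | big i) \sum_(G : {set I} | (#|G| == k) && (deg G + d i == n)%N)
    f (i |: G).
Proof.
pose F G i := if big i && (deg G + d i == n)%N then f (i |: G) else 0.
transitivity (\sum_(A : {set I} | #|A| == k.+1) \sum_(i in A) F (A :\ i) i).
  rewrite big_mkcondr; apply: eq_bigr => A _; rewrite /nbig natr_sum mulr_suml.
  case: ifPn => dA.
    apply: eq_bigr => i iA; rewrite /F addnC -degD1// dA andbT finset.setD1K//.
    by case: (big i); rewrite ?mul1r ?mul0r.
  rewrite big1// => i iA; rewrite /F addnC -degD1// (negbTE dA) andbF//.
rewrite (sum_setU1 F).
rewrite [RHS](eq_bigr (fun i => \sum_(G : {set I} | #|G| == k) F G i)); last first.
  by move=> i bi; rewrite big_mkcondr/=; apply: eq_bigr => G _; rewrite /F bi.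
rewrite [RHS]exchange_big/=; apply: eq_bigr => G _.
rewrite big_mkcond [RHS]big_mkcond/=; apply: eq_bigr => i _.
have [iG|iG] := boolP (i \in G); rewrite /F; case: (boolP (big i)) => //= bi.
by case: ifPn => // h; move: (big_notin bi h); rewrite iG.
Qed.

Lemma sum_deg_wt : \sum_i (d i)%:R * p ^+ d i <= n%:R.
Proof.
have dlt i : ((d i).-1 < n)%N by rewrite prednK ?d1 ?dn.
rewrite (partition_big (fun i => Ordinal (dlt i)) xpredT)//=.
apply: (@le_trans _ _ (\sum_(D < n) 1)).
  apply: ler_sum => D _; rewrite (eq_bigl (fun i => true && (d i == D.+1))).
    exact: sum_deg_eq.
  move=> i /=; rewrite -val_eqE/= -[in RHS](@prednK (d i)) ?d1//.
by rewrite sumr_const card_ord.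
Qed.

(** Markov's inequality for the degree. Marking a factor bounds the weighted sum of the degrees by n
    times the symmetric sum of one order less, which [elsym_ratio_iter] makes at most 2 * th * n *
    [elsym k]; the threshold n/4 brings the factor 4. *)
Lemma Mtail_le (th : R) : 0 <= th <= 1 -> 0 < L -> k%:R <= th * L ->
  Mtail <= 8 * th * elsym k.
Proof.
move=> th01 L0 kL.
have n0' : 0 < n%:R :> R by rewrite ltr0n.
suff H : \sum_(G : {set I} | #|G| == k) (deg G)%:R * wt G <= 2 * th * elsym k * n%:R.
  rewrite -(ler_pM2l n0').
  have : n%:R * Mtail <= 4 * \sum_(G : {set I} | #|G| == k) (deg G)%:R * wt G.
    rewrite /Mtail !mulr_sumr big_mkcondr/=; apply: ler_sum => G _.
    case: ifPn => nG; last by rewrite !mulr_ge0// wt_ge0.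
    by rewrite mulrA ler_wpM2r ?wt_ge0// -natrM ler_nat ltnW.
  by move: H; move: (\sum_(G | _) _) Mtail (elsym k) => a b c; lra.
move: th01 => /andP[th0 th1].
case: k kL => [|j] jL.
  rewrite big1 ?mulr_ge0 ?elsym_ge0// => G.
  by rewrite cards_eq0 => /eqP ->; rewrite /deg big_set0 mul0r.
have -> : \sum_(G : {set I} | #|G| == j.+1) (deg G)%:R * wt G =
    \sum_(G : {set I} | #|G| == j.+1) \sum_(i in G) (d i)%:R * p ^+ d i * wt (G :\ i).
  apply: eq_bigr => G _; rewrite {1}/deg natr_sum mulr_suml.
  by apply: eq_bigr => i iG; rewrite -mulrA -wtD1.
rewrite (sum_setU1 (fun G i => (d i)%:R * p ^+ d i * wt G)).
apply: (@le_trans _ _ (\sum_(G : {set I} | #|G| == j) n%:R * wt G)).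
  apply: ler_sum => G _; rewrite -mulr_suml ler_wpM2r ?wt_ge0//.
  apply: le_trans sum_deg_wt; rewrite [leRHS](bigID (mem G))/= lerDr.
  by apply: sumr_ge0 => i _; rewrite mulr_ge0// exprn_ge0// ltW ?p_gt0.
rewrite -mulr_sumr -/(elsym j) mulrC ler_wpM2r//.
have := @elsym_ratio_iter th j.+1 1; rewrite th0 th1 subn1 expr1 => H.
by apply: H.
Qed.

Definition nb_big m : R := \sum_(i | big i && (m + d i == n)%N) 1.

Lemma NbigE : Nbig = \sum_(G : {set I} | #|G| == k) nb_big (deg G).
Proof.
transitivity (\sum_(A | target A) (nbig A)%:R * 1 : R).
  by apply: eq_bigr => A _; rewrite mulr1.
rewrite sum_target (eq_bigr (fun i => \sum_(G : {set I} | #|G| == k)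
  if (deg G + d i == n)%N then 1 else 0)); last first.
  by move=> i _; rewrite big_mkcondr.
by rewrite exchange_big/=; apply: eq_bigr => G _; rewrite /nb_big big_mkcondr.
Qed.

(** For a cofactor of degree at most n/4 every index of the complementary degree is big, so [cnt_ge]
    counts its completions. *)
Lemma Nbig_ge : q%:R ^+ n * (elsym k - Mtail) <= 2 * n%:R * Nbig.
Proof.
have -> : elsym k - Mtail =
    \sum_(G : {set I} | (#|G| == k) && ~~ (n < 4 * deg G)%N) wt G.
  by rewrite /elsym (bigID (fun G : {set I} => (n < 4 * deg G)%N))/= addrAC subrr add0r.
rewrite NbigE /nb_big.
rewrite !mulr_sumr big_mkcondr/=; apply: ler_sum => G _.
case: ifPn => [|_]; last by rewrite mulr_ge0// sumr_ge0.
rewrite -leqNgt => Gn; have Gn' : (deg G <= n)%N by move: Gn n0; lia.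
rewrite qpE// sumr_const.
have -> : #|(fun i => big i && (deg G + d i == n)%N) : pred I| =
    cnt (n - deg G)%N.
  apply: eq_card => i; transitivity (big i && (deg G + d i == n)%N) => //.
  rewrite [RHS]inE.
  rewrite -(eqn_add2l (deg G) (d i)) subnKC//; case: eqP; rewrite ?andbF// andbT.
  by rewrite /big => h; move: Gn n0; lia.
have := @cnt_ge (n - deg G)%N.
rewrite leq_subr andbT subn_gt0 => /(_ _)H.
have {H}/H : (deg G < n)%N by move: Gn n0; lia.
move=> H; rewrite -natrX -!natrM ler_nat; apply: (leq_trans H).
by rewrite leq_mul// leq_mul// leq_subr.
Qed.

(** The factor n is written as the sum of the degrees of the factors. Without a big factor, the
    cofactor of any marked one has degree above n/4, and [cnt_le] bounds the degree of the marked
    factor times the number of its choices. *)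
Lemma Nbad_le : n%:R * (Ntot - Nbig) <= q%:R ^+ n * Mtail.
Proof.
pose F G i : R := if ~~ big i && (deg G + d i == n)%N then (d i)%:R else 0.
apply: (@le_trans _ _ (\sum_(A : {set I} | #|A| == k.+1) \sum_(i in A) F (A :\ i) i)).
  rewrite /Ntot /Nbig -sumrB mulr_sumr big_mkcondr/=; apply: ler_sum => A Ak.
  case: ifPn => dA; last first.
    by apply: sumr_ge0 => i _; rewrite /F; case: ifP.
  have tA : target A by rewrite /target Ak.
  have [nb0|] := posnP (nbig A).
    rewrite nb0 subr0 mulr1 -{1}(eqP dA) /deg natr_sum le_eqVlt.
    apply/orP; left; apply/eqP; apply: eq_bigr => i iA.
    rewrite /F addnC -degD1// dA andbT.
    move: nb0 => /eqP; rewrite sum_nat_eq0 => /forallP/(_ i)/implyP/(_ iA).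
    by case: (big i).
  move=> nb; have -> : nbig A = 1%N by apply/eqP; rewrite eqn_leq nbig_le1.
  rewrite subrr mulr0; apply: sumr_ge0 => i _; rewrite /F; case: ifP => //.
rewrite (sum_setU1 F) /Mtail mulr_sumr big_mkcondr/=; apply: ler_sum => G _.
case: ifPn => [nG|]; last first.
  rewrite -leqNgt => nG; rewrite big1// => i _; rewrite /F; case: ifP => //.
  by rewrite /big => /andP[h1 /eqP h2]; exfalso; move: nG h1 h2; lia.
have [Gn|nG'] := ltnP (deg G) n; last first.
  rewrite big1 ?mulr_ge0 ?exprn_ge0 ?wt_ge0// => i _; rewrite /F; case: ifP => //.
  by move=> /andP[_ /eqP h2]; exfalso; move: nG' h2 (d1 i); lia.
rewrite qpE ?(ltnW Gn)//.
apply: (@le_trans _ _ (\sum_(i | (d i == n - deg G)%N) (n - deg G)%N%:R)).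
  rewrite [leRHS](bigID (fun i => i \notin G))/= -[leLHS]addr0 lerD ?sumr_ge0//.
  rewrite [leRHS](eq_bigl _ _ (fun i => andbC _ _)) [leRHS]big_mkcondr/=.
  apply: ler_sum => i _; rewrite -(eqn_add2l (deg G) (d i)) subnKC ?(ltnW Gn)// /F.
  case: eqP => [<-|]; last by rewrite andbF.
  by rewrite andbT addKn; case: ifP.
rewrite sumr_const -cardsE -natrX -[X in X <= _]mulr_natr -natrM ler_nat.
exact: cnt_le.
Qed.

Lemma Nbig_ge_esym (th : R) : 0 <= th <= 16^-1 -> 0 < L -> k%:R <= th * L ->
  q%:R ^+ n * elsym k <= 4 * n%:R * Nbig.
Proof.
move=> /andP[th0 th1] L0 kL.
have th01 : 0 <= th <= 1 by rewrite th0 (le_trans th1)// invf_le1// ler1n.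
have M := Mtail_le th01 L0 kL.
have : Mtail <= elsym k / 2.
  apply: (le_trans M); have := ler_wpM2r (elsym_ge0 k) th1; lra.
move=> M2; have := Nbig_ge.
have : q%:R ^+ n * (elsym k / 2) <= q%:R ^+ n * (elsym k - Mtail).
  by rewrite ler_wpM2l ?exprn_ge0//; lra.
lra.
Qed.

Lemma Nbad_le_Nbig (th : R) : 0 <= th <= 16^-1 -> 0 < L -> k%:R <= th * L ->
  Ntot - Nbig <= 32 * th * Nbig.
Proof.
move=> th16 L0 kL; have H := Nbig_ge_esym th16 L0 kL.
move: th16 => /andP[th0 th1].
have th01 : 0 <= th <= 1 by rewrite th0 (le_trans th1)// invf_le1// ler1n.
have M := Mtail_le th01 L0 kL.
have n0' : 0 < n%:R :> R by rewrite ltr0n.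
rewrite -(ler_pM2l n0'); apply: (le_trans Nbad_le).
have := ler_wpM2l (exprn_ge0 n (ltW q_gt0)) M.
have := ler_wpM2l th0 H.
move: (q%:R ^+ n) (elsym k) Mtail Nbig (n%:R) => a b c e f; lra.
Qed.

Lemma Nbig_le_Ntot : Nbig <= Ntot.
Proof. by apply: ler_sum => A tA; rewrite lern1 nbig_le1. Qed.

(** * Fourier analysis of the conditional variance *)

Notation Delta A B := ((A :\: B) :|: (B :\: A)).

Lemma Delta_eq0 A B : (Delta A B == finset.set0) = (A == B).
Proof.
apply/eqP/eqP => [|->]; last by rewrite finset.setDv finset.setU0.
move/setP => h; apply/setP => i; have := h i; rewrite !inE.
by case: (i \in A); case: (i \in B).
Qed.

(** Parseval's identity: by [chiM] and [mean_chi] the characters are orthonormal. *)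
Lemma mean_sqr_chi (P : pred {set I}) (c : {set I} -> R) :
  mean (fun e => (\sum_(X | P X) c X * chi R X e) ^+ 2) = \sum_(X | P X) c X ^+ 2.
Proof.
transitivity (mean (fun e => \sum_(X | P X) \sum_(Y | P Y) c X * c Y * chi R (Delta X Y) e)).
  apply: eq_mean => e; rewrite expr2 mulr_suml; apply: eq_bigr => X _.
  by rewrite mulr_sumr; apply: eq_bigr => Y _; rewrite -chiM; ring.
rewrite mean_sum; apply: eq_bigr => X PX; rewrite mean_sum (bigD1 X)//=.
rewrite meanZ mean_chi Delta_eq0 eqxx mulr1 -expr2 big1 ?addr0// => Y /andP[_ YX].
by rewrite meanZ mean_chi Delta_eq0 eq_sym (negbTE YX) mulr0.
Qed.

(** For big [i], the factor a(P) that multiplies the sign of [i], see [sum_nbig_chi]. *)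
Definition coef i (e : {ffun I -> bool}) : R :=
  \sum_(G : {set I} | (#|G| == k) && (deg G + d i == n)%N) chi R G e.

Definition gen_pair (x : {set I} * {set I}) :=
  [&& #|x.1| == k, #|x.2| == k & deg x.1 == deg x.2].

(* The Fourier coefficient at [X] of the conditional variance, see [sum_sqr_coef]. *)
Definition vcoef X : R :=
  \sum_(x | gen_pair x && (Delta x.1 x.2 == X)) nb_big (deg x.1).

Lemma sum_sqr_coef e : \sum_(i | big i) coef i e ^+ 2 = \sum_X vcoef X * chi R X e.
Proof.
transitivity (\sum_(x | gen_pair x) nb_big (deg x.1) * chi R (Delta x.1 x.2) e).
  rewrite [RHS](eq_bigr (fun x => \sum_(i | big i)
      if (deg x.1 + d i == n)%N then chi R (Delta x.1 x.2) e else 0)); last first.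
    move=> x _; rewrite /nb_big mulr_suml big_mkcondr/=; apply: eq_bigr => i _.
    by case: ifP; rewrite ?mul1r ?mul0r.
  rewrite exchange_big/=; apply: eq_bigr => i _; rewrite -big_mkcondr/=.
  rewrite expr2 /coef big_distrlr/= pair_big/=; apply: eq_big => [[A B]|[A B] _]/=.
    rewrite /gen_pair/=; case: (#|A| == k); case: (#|B| == k); rewrite ?andbF//=.
    apply/andP/andP => -[/eqP h1 /eqP h2]; split; apply/eqP => //.
      by apply/eqP; rewrite -(eqn_add2r (d i)) h1 h2.
    by rewrite -h1.
  by rewrite chiM.
rewrite (partition_big (fun x => Delta x.1 x.2) xpredT)//=.
apply: eq_bigr => X _; rewrite /vcoef mulr_suml.
by apply: eq_bigr => x /andP[_ /eqP ->].
Qed.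

(** Only diagonal pairs have an empty symmetric difference. Hence the conditional variance has mean
    [Nbig], and its fluctuation lies in the other coefficients. *)
Lemma vcoef0 : vcoef finset.set0 = Nbig.
Proof.
rewrite NbigE /vcoef.
rewrite (reindex_onto (fun G : {set I} => (G, G)) (fun x => x.1))/=; last first.
  by case=> A B /andP[_]; rewrite Delta_eq0 => /eqP/= ->.
apply: eq_bigl => G; rewrite /gen_pair/= Delta_eq0 !eqxx !andbT.
by rewrite andbb.
Qed.

Lemma nb_big_ge0 m : 0 <= nb_big m. Proof. by apply: sumr_ge0. Qed.

(** A big index has degree at least n/2, so in [cnt_le] the division by the degree costs at most
    2/n. *)
Lemma nb_big_le m : n%:R * nb_big m <= 2 * q%:R ^+ n * p ^+ m.
Proof.
have [/existsP[i0 /andP[b0 /eqP h0]]|] := boolP [exists i, big i && (m + d i == n)%N]; last first.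
  rewrite negb_exists => /forallP none.
  rewrite /nb_big big_pred0; last by move=> i; exact/negbTE.
  by rewrite mulr0 !mulr_ge0 ?exprn_ge0// ltW ?q_gt0 ?p_gt0.
have mn : (m < n)%N by have := d1 i0; move: h0; lia.
rewrite -mulrA qpE ?(ltnW mn)//.
apply: (@le_trans _ _ (n%:R * (cnt (n - m)%N)%:R)).
  rewrite ler_wpM2l// /nb_big big_mkcond/= -sum1_card natr_sum [leRHS]big_mkcond/=.
  apply: ler_sum => i _; rewrite inE -(eqn_add2l m (d i)) subnKC ?(ltnW mn)//.
  by case: (m + d i == n)%N; rewrite ?andbF// andbT; case: (big i).
rewrite -natrX -natrM -natrM ler_nat.
have := cnt_le (n - m)%N; rewrite -(leq_pmul2l (isT : (0 < 2)%N)).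
apply: leq_trans; rewrite mulnA leq_mul2r; apply/orP; right.
by move: b0 h0; rewrite /big; lia.
Qed.

(* If [Y] and [X :\: Y] are balanced then [wt Y ^ 2 = wt X], which makes the square
   sums of [vcoef] computable in terms of [rho]. *)
Definition balanced Y (Z : {set I}) := (#|Y| == #|Z|) && (deg Y == deg Z).

Lemma pair_decomp (G G' : {set I}) X : Delta G G' = X ->
  [/\ G :\: G' \subset X, X :\: (G :\: G') = G' :\: G,
     G = (G :\: G') :|: (G :&: G') & G' = (X :\: (G :\: G')) :|: (G :&: G')].
Proof.
move=> <-; split.
- exact: finset.subsetUl.
- by apply/setP => i; rewrite !inE; case: (i \in G); case: (i \in G').
- by apply/setP => i; rewrite !inE; case: (i \in G); case: (i \in G').
- by apply/setP => i; rewrite !inE; case: (i \in G); case: (i \in G').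
Qed.

(** A pair (G, G') with symmetric difference X is determined by Y = G :\: G' and C = G :&: G'. Equal
    sizes and degrees make Y balanced in X, and C ranges over sets of k - #|Y| indices, whose total
    weight [elsym_ratio_iter] bounds by (2 * th)^#|Y| * [elsym k]. *)
Lemma vcoef_le (th : R) X : 0 <= th <= 1 -> 0 < L -> k%:R <= th * L ->
  n%:R * vcoef X <= 2 * q%:R ^+ n * elsym k *
    \sum_(Y : {set I} | (Y \subset X) && balanced Y (X :\: Y)) (2 * th) ^+ #|Y| * wt Y.
Proof.
move=> th01 L0 kL.
pose Q (x : {set I} * {set I}) := ((x.1 \subset X) && balanced x.1 (X :\: x.1)) &&
   (#|x.2| + #|x.1| == k)%N.
apply: (@le_trans _ _ (2 * q%:R ^+ n * \sum_(x | Q x) wt x.1 * wt x.2)).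
  apply: (@le_trans _ _ (2 * q%:R ^+ n * \sum_(x | gen_pair x && (Delta x.1 x.2 == X)) wt x.1)).
    rewrite /vcoef !mulr_sumr; apply: ler_sum => x _; exact: nb_big_le.
  have K0 : 0 <= 2 * q%:R ^+ n :> R by rewrite mulr_ge0// exprn_ge0// ltW ?q_gt0.
  rewrite ler_wpM2l//.
  have disj A B : [disjoint A :\: B & A :&: B]%B.
    rewrite -finset.setI_eq0; apply/eqP/setP => i; rewrite !inE.
    by case: (i \in A); case: (i \in B).
  have -> : \sum_(x | gen_pair x && (Delta x.1 x.2 == X)) wt x.1 =
     \sum_(x | gen_pair x && (Delta x.1 x.2 == X))
       (fun z : {set I} * {set I} => wt z.1 * wt z.2) (x.1 :\: x.2, x.1 :&: x.2).
    apply: eq_bigr => -[A B] _ /=.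
    by rewrite -wtU//; congr wt; rewrite finset.setUC finset.setID.
  apply: (@ler_sum_inj _ _ _ _ Q (fun x : {set I} * {set I} => (x.1 :\: x.2, x.1 :&: x.2))
     (fun z : {set I} * {set I} => wt z.1 * wt z.2)).
  - move=> [A B] [A' B'] /andP[_ /eqP h] /andP[_ /eqP h'] [e1 e2].
    have [_ _ hA hB] := pair_decomp h; have [_ _ hA' hB'] := pair_decomp h'.
    rewrite /= in hA hB hA' hB'.
    by congr (_, _); [rewrite hA hA' e1 e2|rewrite hB hB' e1 e2].
  - move=> [A B] /andP[/and3P[/= /eqP Ak /eqP Bk /eqP AB] /eqP h].
    have [h1 h2 hA hB] := pair_decomp h.
    have cA : #|A| = (#|A :\: B| + #|A :&: B|)%N by rewrite addnC cardsID.
    have cB : #|B| = (#|B :\: A| + #|A :&: B|)%N by rewrite addnC finset.setIC cardsID.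
    have gA : deg A = (deg (A :\: B) + deg (A :&: B))%N by rewrite {1}hA degU.
    have gB : deg B = (deg (B :\: A) + deg (A :&: B))%N.
      rewrite -{1}(finset.setID B A) finset.setUC degU; first by rewrite finset.setIC.
      exact: disj.
    rewrite /Q /balanced /= h1 h2 /=; apply/andP; split; last by rewrite addnC -cA Ak.
    apply/andP; split; apply/eqP; apply/eqP.
      by rewrite -(eqn_add2r #|A :&: B|) -cA -cB Ak Bk.
    by rewrite -(eqn_add2r (deg (A :&: B))) -gA -gB AB.
  - by move=> y _; rewrite mulr_ge0 ?wt_ge0.
rewrite -[leRHS]mulrA ler_wpM2l//.
rewrite -(pair_big_dep (fun Y : {set I} => (Y \subset X) && balanced Y (X :\: Y))
  (fun Y C : {set I} => (#|C| + #|Y| == k)%N) (fun Y C => wt Y * wt C))/=.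
rewrite mulr_sumr; apply: ler_sum => Y _; rewrite -mulr_sumr.
rewrite [leRHS]mulrA [leRHS]mulrC ler_wpM2l ?wt_ge0//.
have [Yk|Yk] := leqP #|Y| k; last first.
  rewrite big_pred0 ?mulr_ge0 ?elsym_ge0 ?exprn_ge0 ?mulr_ge0//; first by case/andP: th01.
  by move=> C; apply/eqP; move: Yk; lia.
have := elsym_ratio_iter th01 L0 kL Yk; rewrite [leRHS]mulrC => H.
apply: le_trans H; rewrite le_eqVlt; apply/orP; left; apply/eqP.
by apply: eq_bigl => C; rewrite -(eqn_add2r #|Y| #|C|) subnK.
Qed.

(** Cauchy-Schwarz over the balanced subsets of X, of which there are at most 2^#|X| = 4^#|Y|.
    Balance then turns [wt Y ^+ 2] into the weight of the pair of Y and its complement in X. *)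
Lemma sqr_vcoef_le (th : R) X : 0 <= th <= 1 -> 0 < L -> k%:R <= th * L ->
  (n%:R * vcoef X) ^+ 2 <= (2 * q%:R ^+ n * elsym k) ^+ 2 *
    \sum_(Y : {set I} | (Y \subset X) && balanced Y (X :\: Y))
       (16 * th ^+ 2) ^+ #|Y| * (wt Y * wt (X :\: Y)).
Proof.
move=> th01 L0 kL; have th0 : 0 <= th by case/andP: th01.
have K0 : 0 <= 2 * q%:R ^+ n * elsym k.
  by rewrite !mulr_ge0 ?elsym_ge0// exprn_ge0// ltW ?q_gt0.
pose u := \sum_(Y : {set I} | (Y \subset X) && balanced Y (X :\: Y)) (2 * th) ^+ #|Y| * wt Y.
have u0 : 0 <= u.
  by apply: sumr_ge0 => Y _; rewrite mulr_ge0 ?wt_ge0// exprn_ge0// mulr_ge0.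
have v0 : 0 <= n%:R * vcoef X.
  by rewrite mulr_ge0// sumr_ge0// => x _; exact: nb_big_ge0.
apply: (@le_trans _ _ ((2 * q%:R ^+ n * elsym k * u) ^+ 2)).
  have Ku : 0 <= 2 * q%:R ^+ n * elsym k * u by exact: mulr_ge0.
  rewrite ler_pXn2r ?nnegrE//.
  exact: vcoef_le th01 L0 kL.
rewrite exprMn ler_wpM2l ?sqr_ge0//.
apply: (le_trans (sqr_sum_le_card _ _)); rewrite mulr_sumr.
apply: ler_sum => Y /andP[YX /andP[/eqP cY /eqP dY]].
have card_le : (#|[pred Y : {set I} | (Y \subset X) && balanced Y (X :\: Y)]| <= 4 ^ #|Y|)%N.
  rewrite (_ : 4 = 2 ^ 2)%N// -expnM mul2n -addnn {2}cY.
  have -> : (#|Y| + #|X :\: Y|)%N = #|X|.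
    by rewrite -(cardsID Y X) (finset.setIidPr YX).
  rewrite -card_powerset; apply: subset_leq_card; apply/fintype.subsetP => Z.
  by rewrite inE powersetE => /andP[].
have wY : wt Y * wt (X :\: Y) = wt Y ^+ 2 by rewrite expr2 {2}/wt -dY.
rewrite wY.
have -> : (16 * th ^+ 2) ^+ #|Y| = 4 ^+ #|Y| * ((2 * th) ^+ #|Y|) ^+ 2.
  by rewrite -exprM mulnC exprM -exprMn; congr (_ ^+ _); ring.
rewrite -mulrA -exprMn ler_wpM2r ?sqr_ge0// -natrX ler_nat.
exact: card_le.
Qed.

Lemma sum_geom_le2 (t : R) N : 0 <= t <= 2^-1 -> \sum_(r < N) t ^+ r <= 2.
Proof.
move=> /andP[t0 t1]; elim: N => [|N IH]; first by rewrite big_ord0.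
rewrite big_ord_recl/=; under eq_bigr do rewrite exprS.
rewrite -mulr_sumr expr0.
have := ler_pM t0 _ t1 IH; rewrite sumr_ge0; last by move=> *; rewrite exprn_ge0.
move=> /(_ isT); lra.
Qed.

(** Summed over X, the bound of [sqr_vcoef_le] runs over balanced pairs, and [sum_balanced_pairs]
    gives those of size r at most 2 * t^r with t = 256 * th^2. As X is nonempty, so is Y; the
    geometric series starts at r = 1 and is at most 4 * t. *)
Lemma sum_vcoef_le (th : R) : 0 <= th <= 32^-1 -> 0 < L -> k%:R <= th * L ->
  \sum_(X : {set I} | X != finset.set0) vcoef X ^+ 2 <= (256 * th * Nbig) ^+ 2.
Proof.
move=> /andP[th0 th1] L0 kL.
have th01 : 0 <= th <= 1 by rewrite th0 (le_trans th1)// invf_le1// ler1n.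
have th16 : 0 <= th <= 16^-1 by rewrite th0/= (le_trans th1)// lef_pV2 ?posrE// ler_nat.
have n0' : 0 < n%:R :> R by rewrite ltr0n.
have K0 : 0 <= 2 * q%:R ^+ n * elsym k.
  by rewrite !mulr_ge0 ?elsym_ge0// exprn_ge0// ltW ?q_gt0.
pose g (x : {set I} * {set I}) := (16 * th ^+ 2) ^+ #|x.1| * (wt x.1 * wt x.2).
have g0 x : 0 <= g x.
  by rewrite /g !mulr_ge0 ?wt_ge0// exprn_ge0// mulr_ge0// sqr_ge0.
pose t := 256 * th ^+ 2.
have t0 : 0 <= t <= 2^-1.
  apply/andP; split; first by rewrite mulr_ge0 ?ler0n ?sqr_ge0.
  exact: sqr_le_half.
have B : \sum_(X : {set I} | X != finset.set0)
    \sum_(Y : {set I} | (Y \subset X) && balanced Y (X :\: Y))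
     g (Y, X :\: Y) <= 4 * t.
  rewrite pair_big_dep/=.
  pose P (x : {set I} * {set I}) := balanced x.1 x.2 && (0 < #|x.1|)%N.
  apply: (@le_trans _ _ (\sum_(x | P x) g x)).
    apply: (@ler_sum_inj _ _ _ _ P (fun x : {set I} * {set I} => (x.2, x.1 :\: x.2)) g) => //.
    - move=> [X Y] [X' Y'] /and3P[_ YX _] /and3P[_ YX' _] [e1 e2].
      rewrite -(finset.setID X Y) -(finset.setID X' Y').
      by rewrite (finset.setIidPr YX) (finset.setIidPr YX') e2 e1.
    - move=> [X Y] /= /and3P[X0 YX bal]; rewrite /P/= bal/= lt0n.
      apply: contra X0 => /eqP Y0; move: bal => /andP[/eqP cY _].
      by rewrite -cards_eq0 -(cardsID Y X) (finset.setIidPr YX) Y0 -cY Y0.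
  have cl (x : {set I} * {set I}) : (#|x.1|.-1 < #|I|.+1)%N.
    by rewrite ltnS (leq_trans (leq_pred _))// max_card.
  rewrite (partition_big (fun x => Ordinal (cl x)) xpredT)//=.
  apply: (@le_trans _ _ (\sum_(r < #|I|.+1) 2 * t * t ^+ r)); last first.
    have := sum_geom_le2 #|I|.+1 t0; rewrite -mulr_sumr => H.
    have : 2 * t * \sum_(r < #|I|.+1) t ^+ r <= 2 * t * 2.
      by rewrite ler_wpM2l// mulr_ge0//; case/andP: t0.
    lra.
  apply: ler_sum => r _.
  apply: (@le_trans _ _ (\sum_(x : {set I} * {set I} |
      [&& #|x.1| == r.+1, #|x.2| == r.+1 & deg x.1 == deg x.2])
        (16 * th ^+ 2) ^+ r.+1 * (wt x.1 * wt x.2))).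
    rewrite le_eqVlt; apply/orP; left; apply/eqP; apply: eq_big => [[A B]|[A B]]/=.
      rewrite /P /balanced/= -val_eqE/=.
      apply/andP/and3P => [[/andP[/andP[/eqP h1 h2] h3] /eqP h4]|[/eqP h1 /eqP h2 h3]].
        by rewrite -h1 -h4 prednK// eqxx.
      by rewrite h1 h2 h3/= eqxx.
    rewrite /P /g/= -val_eqE/= => /andP[/andP[_ h3] /eqP h4].
    by rewrite -h4 prednK.
  rewrite -mulr_sumr.
  have -> : 2 * t * t ^+ r = (16 * th ^+ 2) ^+ r.+1 * (2 * 16 ^+ r.+1).
    by rewrite -mulrA -exprS mulrCA -exprMn; congr (_ * _ ^+ _); rewrite /t; ring.
  by rewrite ler_wpM2l ?exprn_ge0 ?mulr_ge0 ?sqr_ge0// sum_balanced_pairs.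
have H1 : n%:R ^+ 2 * \sum_(X : {set I} | X != finset.set0) vcoef X ^+ 2 <=
    (2 * q%:R ^+ n * elsym k) ^+ 2 * (4 * t).
  apply: le_trans (ler_wpM2l (sqr_ge0 _) B).
  rewrite [leLHS]mulr_sumr [leRHS]mulr_sumr; apply: ler_sum => X _.
  rewrite -exprMn; exact: sqr_vcoef_le.
have H2 : (2 * q%:R ^+ n * elsym k) ^+ 2 <= (8 * n%:R * Nbig) ^+ 2.
  have := Nbig_ge_esym th16 L0 kL => H.
  have N0 : 0 <= Nbig by apply: sumr_ge0.
  have N1 : 0 <= 8 * n%:R * Nbig by rewrite !mulr_ge0.
  rewrite ler_pXn2r ?nnegrE//; lra.
rewrite -(ler_pM2l (exprn_gt0 2 n0')); apply: (le_trans H1).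
apply: le_trans (ler_wpM2r _ H2) _; first by rewrite mulr_ge0//; case/andP: t0.
by rewrite le_eqVlt; apply/orP; left; apply/eqP; rewrite /t; ring.
Qed.

Lemma mean_norm_variance (th : R) : 0 <= th <= 32^-1 -> 0 < L -> k%:R <= th * L ->
  mean (fun e => `|\sum_(i | big i) coef i e ^+ 2 - Nbig|) <= 256 * th * Nbig.
Proof.
move=> th32 L0 kL; apply: (le_trans (mean_norm_le_sqrt _)).
have -> : mean (fun e => (\sum_(i | big i) coef i e ^+ 2 - Nbig) ^+ 2) =
    mean (fun e => (\sum_(X : {set I} | X != finset.set0) vcoef X * chi R X e) ^+ 2).
  apply: eq_mean => e; congr (_ ^+ _).
  by rewrite sum_sqr_coef [X in X - _](bigD1 finset.set0)//= vcoef0 chi0 mulr1 addrAC subrr add0r.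
rewrite mean_sqr_chi.
apply: (le_trans (ler_wsqrtr (sum_vcoef_le th32 L0 kL))).
have N0 : 0 <= Nbig by apply: sumr_ge0 => *; rewrite ler0n.
case/andP: th32 => th0 _.
have t0 : 0 <= 256 * th * Nbig by apply: mulr_ge0 N0; apply: mulr_ge0 th0; rewrite ler0n.
by rewrite sqrtr_sqr (ger0_norm t0).
Qed.

(** * The central limit theorem with explicit errors *)

Lemma coef_le i e : (d i <= n)%N -> `|coef i e| <= q%:R ^+ (n - d i).
Proof.
move=> din; apply: (@le_trans _ _ (q%:R ^+ (n - d i) * rho k (n - d i))); last first.
  by rewrite ler_piMr ?rho_le1// exprn_ge0// ltW ?q_gt0.
apply: (le_trans (ler_norm_sum _ _ _)); rewrite /rho mulr_sumr.
rewrite le_eqVlt; apply/orP; left; apply/eqP; apply: eq_big => G.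
  by rewrite -(eqn_add2r (d i) _ (n - d i)) subnK.
move=> /andP[_ /eqP h]; rewrite /wt (_ : deg G = n - d i)%N ?qpE// ?subnn; last first.
  by rewrite -h addnK.
rewrite expr0 /chi normr_prod big1// => j _; by rewrite normrX normrN1 expr1n.
Qed.
Lemma elsym_ge1 (th : R) : 0 <= th <= 2^-1 -> 0 < L -> k%:R <= th * L -> 1 <= elsym k.
Proof.
move=> /andP[th0 th1] L0 kL.
have th01 : 0 <= th <= 1 by rewrite th0 (le_trans th1)// invf_le1// ler1n.
have := elsym_ratio_iter th01 L0 kL (leqnn k).
rewrite subnn {1}/elsym (big_pred1 finset.set0); last by move=> A; rewrite /= cards_eq0.
rewrite /wt /deg big_set0 expr0 => /le_trans; apply.
rewrite ler_piMl ?elsym_ge0// exprn_ile1 ?mulr_ge0//; lra.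
Qed.

Definition chi_sum (e : {ffun I -> bool}) : R := \sum_(A | target A) chi R A e.

Lemma sum_nbig_chi e :
  \sum_(A | target A) (nbig A)%:R * chi R A e =
  \sum_(i | big i) (-1) ^+ e i * coef i e.
Proof.
rewrite sum_target; apply: eq_bigr => i bi; rewrite /coef mulr_sumr.
apply: eq_bigr => G /andP[_ h]; rewrite /chi big_setU1//.
exact: (big_notin bi h).
Qed.

(** On targets [nbig] is 0 or 1, so by Parseval the mean square counts the products without a big
    factor. *)
Lemma mean_sqr_bad : mean (fun e => (chi_sum e -
    \sum_(i | big i) (-1) ^+ e i * coef i e) ^+ 2) = Ntot - Nbig.
Proof.
transitivity (mean (fun e => (\sum_(A | target A) (1 - (nbig A)%:R) * chi R A e) ^+ 2)).
  apply: eq_mean => e; congr (_ ^+ _).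
  rewrite -sum_nbig_chi /chi_sum -sumrB; apply: eq_bigr => A _.
  by rewrite mulrBl mul1r.
rewrite mean_sqr_chi /Ntot /Nbig -sumrB; apply: eq_bigr => A /nbig_le1.
by case: (nbig A) => [|[|//]] _; rewrite ?subr0 ?subrr ?expr1n ?expr0n.
Qed.

(** The cofactors of a big index have degree at most n/4, so they contain no big index. *)
Lemma coef_indep i j : big i -> big j -> indep i (coef j).
Proof.
move=> bi bj e; apply: eq_bigr => G /andP[_ /eqP h]; apply: chi_indep.
apply/negP => iG; move: h bi bj n0; rewrite (degD1 iG) /big.
move: (deg _) => ?; lia.
Qed.

Lemma big_codegree i : big i -> ((n - d i) * 4 <= n)%N.
Proof. by rewrite /big; lia. Qed.

Let bound_step3 (th x u v : R) : x <= 256 * th * u -> v - u <= 32 * th * u ->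
  th * u <= th * v -> x + (v - u) <= 288 * th * v.
Proof. lra. Qed.

(** The errors come, in this order, from the products without a big factor, from Lindeberg
    replacement, and from the distance of the conditional variance to 1, where 288 = 256 + 32 adds
    its fluctuation and the defect of its mean. [D] bounds the normalised coefficients: their fourth
    powers are at most q^n / Ntot^2, and Ntot >= q^n / (4 * n). *)
Lemma chi_sum_clt (th D s y : R) :
  0 <= th <= 32^-1 -> 0 < L -> k%:R <= th * L ->
  0 <= D -> 16 * n%:R ^+ 2 <= D ^+ 4 * q%:R ^+ n -> 0 < s ->
  `|mean (fun e => heat s (y - (Num.sqrt Ntot)^-1 * chi_sum e)) - heat (s + 1) y| <=
    Num.sqrt (32 * th) / Num.sqrt s + 4 / (s * Num.sqrt s) * D
    + `|y| / (s * Num.sqrt s) * (288 * th).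
Proof.
move=> th32 L0 kL D0 Dn s0.
have /andP[th0 th1] := th32.
have th16 : 0 <= th <= 16^-1 by rewrite th0/= (le_trans th1)// lef_pV2 ?posrE// ler_nat.
have th2 : 0 <= th <= 2^-1 by rewrite th0/= (le_trans th1)// lef_pV2 ?posrE// ler_nat.
have n0' : 0 < n%:R :> R by rewrite ltr0n.
have qn0 : 0 < q%:R ^+ n :> R by rewrite exprn_gt0// q_gt0.
have Nbe := Nbig_ge_esym th16 L0 kL.
have e1 := elsym_ge1 th2 L0 kL.
have Nq : q%:R ^+ n <= 4 * n%:R * Nbig.
  by apply: le_trans Nbe; rewrite ler_peMr// ltW.
have Nb0 : 0 < Nbig.
  have : 0 < 4 * n%:R * Nbig by apply: lt_le_trans Nq.
  by rewrite pmulr_rgt0// mulr_gt0.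
have NN := Nbig_le_Ntot.
have N0 : 0 < Ntot by apply: lt_le_trans NN.
have bad := Nbad_le_Nbig th16 L0 kL.
pose sg := Num.sqrt Ntot.
have sg0 : 0 < sg by rewrite sqrtr_gt0.
have sg2 : sg ^+ 2 = Ntot by rewrite sqr_sqrtr// ltW.
have rs0 : 0 < Num.sqrt s by rewrite sqrtr_gt0.
have ss0 : 0 < s * Num.sqrt s by rewrite mulr_gt0.
pose a i (e : {ffun I -> bool}) : R := sg^-1 * coef i e.
pose l := enum (fun i => big i).
have lE (f : I -> R) : \sum_(i <- l) f i = \sum_(i | big i) f i.
  by rewrite /l big_enum.
have inl i : i \in l -> big i by rewrite mem_enum.
pose T (e : {ffun I -> bool}) := \sum_(i <- l) (-1) ^+ e i * a i e.
have TE e : T e = sg^-1 * \sum_(i | big i) (-1) ^+ e i * coef i e.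
  by rewrite /T lE mulr_sumr; apply: eq_bigr => i _; rewrite /a; ring.
pose V (e : {ffun I -> bool}) := \sum_(i <- l) a i e ^+ 2.
have VE e : V e = (\sum_(i | big i) coef i e ^+ 2) / Ntot.
  rewrite /V lE mulr_suml; apply: eq_bigr => i _.
  by rewrite /a exprMn exprVn sg2 mulrC.
have step1 : `|mean (fun e => heat s (y - sg^-1 * chi_sum e)) - mean (fun e => heat s (y - T e))|
    <= Num.sqrt (32 * th) / Num.sqrt s.
  rewrite -meanB; apply: (le_trans (ler_norm_mean _)).
  pose B e := chi_sum e - \sum_(i | big i) (-1) ^+ e i * coef i e.
  apply: (@le_trans _ _ (mean (fun e => (sg^-1 / Num.sqrt s) * `|B e|))).
    apply: ler_mean => e; apply: (le_trans (heat_lip _ _ _)).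
    rewrite TE /B (_ : y - sg^-1 * chi_sum e - _ =
      - (sg^-1 * (chi_sum e - \sum_(i | big i) (-1) ^+ e i * coef i e))); last by ring.
    by rewrite normrN normrM (gtr0_norm (x := sg^-1)) ?invr_gt0// mulrAC.
  rewrite meanZ mulrAC ler_wpM2r ?invr_ge0 ?(ltW rs0)//.
  rewrite mulrC ler_pdivrMr//.
  apply: (le_trans (mean_norm_le_sqrt _)).
  rewrite mean_sqr_bad /sg -sqrtrM; last by rewrite mulr_ge0.
  rewrite ler_wsqrtr// (le_trans bad)// ler_wpM2l// mulr_ge0//.
have aD i e : big i -> `|a i e| <= D.
  move=> bi; rewrite -(@ler_pXn2r _ 4)// ?nnegrE//.
  rewrite /a normrM normfV (gtr0_norm sg0) exprMn exprVn mulrC.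
  rewrite ler_pdivrMr ?exprn_gt0//.
  have c4 : `|coef i e| ^+ 4 <= q%:R ^+ n.
    apply: (@le_trans _ _ ((q%:R ^+ (n - d i)) ^+ 4)).
      by rewrite ler_pXn2r ?nnegrE ?coef_le ?exprn_ge0 ?dn// ltW ?q_gt0.
    rewrite -exprM ler_weXn2l ?ler1n//; first by case: (q) q2.
    exact: big_codegree.
  apply: (le_trans c4).
  have -> : sg ^+ 4 = Ntot ^+ 2 by rewrite -sg2 -exprM.
  have h1 : (q%:R ^+ n) ^+ 2 <= (4 * n%:R * Ntot) ^+ 2.
    have N4 : 0 <= 4 * n%:R * Ntot by rewrite mulr_ge0 ?mulr_ge0 ?ler0n ?(ltW N0).
    rewrite ler_pXn2r ?nnegrE ?(ltW qn0)//.
    apply: (le_trans Nq).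
    by rewrite ler_wpM2l// mulr_ge0.
  have h2 := ler_wpM2r (sqr_ge0 Ntot) Dn.
  rewrite -(ler_pM2r qn0) -expr2 (le_trans h1)//.
  rewrite (_ : (4 * n%:R * Ntot) ^+ 2 = 16 * n%:R ^+ 2 * Ntot ^+ 2); last by ring.
  by rewrite (le_trans h2)// mulrAC.
have mV : mean V = Nbig / Ntot.
  have -> : mean V = mean (fun e => Ntot^-1 * \sum_X vcoef X * chi R X e).
    by apply: eq_mean => e; rewrite VE sum_sqr_coef mulrC.
  rewrite meanZ mulrC; congr (_ / _).
  rewrite mean_sum (bigD1 finset.set0)//= meanZ mean_chi eqxx mulr1 vcoef0.
  by rewrite big1 ?addr0// => X X0; rewrite meanZ mean_chi (negbTE X0) mulr0.
have step2 : `|mean (fun e => heat s (y - T e)) - mean (fun e => heat (s + V e) y)|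
    <= 4 / (s * Num.sqrt s) * D.
  have := @mean_heat_clt R I l (fun=> y) (fun=> s) a s s0 (enum_uniq _) (fun=> lexx s)
    (fun i _ e => erefl) (fun i _ e => erefl).
  have ai : {in l &, forall i j, indep i (a j)}.
    by move=> i j /inl bi /inl bj e; rewrite /a (coef_indep bi bj).
  move=> /(_ ai) /le_trans; apply.
  rewrite ler_wpM2l//; first by rewrite divr_ge0// ltW.
  (* Each cube is at most [D] times a square, and [V] has mean at most 1. *)
  apply: (@le_trans _ _ (mean (fun e => D * V e))).
    apply: ler_mean => e; rewrite /V !lE mulr_sumr; apply: ler_sum => i bi.
    by rewrite exprS real_normK ?num_real// ler_wpM2r ?sqr_ge0// aD.
  by rewrite meanZ mV ler_piMr// ler_pdivrMr// mul1r.
have step3 : `|mean (fun e => heat (s + V e) y) - heat (s + 1) y|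
    <= `|y| / (s * Num.sqrt s) * (288 * th).
  rewrite -[X in _ - X](@mean_cst R I) -meanB.
  apply: (le_trans (ler_norm_mean _)).
  apply: (@le_trans _ _ (mean (fun e => `|y| / (s * Num.sqrt s) * `|V e - 1|))).
    apply: ler_mean => e.
    have V0 : 0 <= V e by rewrite /V sumr_ge0// => i _; rewrite sqr_ge0.
    have := @heat_lip_var R s (s + V e) (s + 1) y s0.
    rewrite !lerDl V0 ler01 => /(_ isT isT).
    by rewrite (_ : s + V e - (s + 1) = V e - 1)//; ring.
  rewrite meanZ ler_wpM2l//; first by rewrite divr_ge0// ltW.
  apply: (@le_trans _ _ (mean (fun e => Ntot^-1 * `|\sum_(i | big i) coef i e ^+ 2 - Nbig|
      + Ntot^-1 * (Ntot - Nbig)))).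
    apply: ler_mean => e; rewrite VE.
    rewrite (_ : _ / Ntot - 1 = Ntot^-1 * (\sum_(i | big i) coef i e ^+ 2 - Nbig)
       - Ntot^-1 * (Ntot - Nbig)); last by field; rewrite gt_eqF.
    apply: (le_trans (ler_normB _ _)); rewrite !normrM.
    by rewrite (gtr0_norm (x := Ntot^-1)) ?invr_gt0// (ger0_norm (x := Ntot - _)) ?subr_ge0.
  rewrite meanD mean_cst meanZ -mulrDr mulrC ler_pdivrMr//.
  have := mean_norm_variance th32 L0 kL => mv.
  exact: bound_step3 mv bad (ler_wpM2l th0 NN).
apply: (le_trans (ler_distD (mean (fun e => heat (s + V e) y)) _ _)).
apply: lerD step3.
apply: (le_trans (ler_distD (mean (fun e => heat s (y - T e))) _ _)).
exact: lerD.
Qed.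
End Weights.

(** * Counting monic irreducible polynomials *)

Section MonicPolynomials.
Variable F : finFieldType.
Implicit Types (G H P Q : {poly F}) (d m : nat).

Lemma monic_degP d G :
  reflect (G \is monic /\ size G = d.+1) (G \in monic_deg F d).
Proof.
apply: (iffP mapP) => [[t _ ->]|[mG sG]].
  have st : (size (Poly (tval t)) < size ('X^d : {poly F}))%N.
    by rewrite size_polyXn ltnS (leq_trans (size_Poly _))// size_tuple.
  by rewrite monicE lead_coefDl// lead_coefXn size_polyDl// size_polyXn.
exists [tuple G`_i | i < d]; first by rewrite mem_enum.
apply/polyP => i; rewrite coefD coefXn coef_Poly.
have [id|di] := ltnP i d.
  by rewrite (ltn_eqF id) add0r -(tnth_nth 0 _ (Ordinal id)) tnth_mktuple.
rewrite [X in _ + X]nth_default ?size_tuple// addr0.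
case: eqP => [->|/eqP nid]; first by move: mG; rewrite monicE lead_coefE sG => /eqP.
by rewrite nth_default// sG ltn_neqAle eq_sym nid.
Qed.

Lemma monic_deg_uniq d : uniq (monic_deg F d).
Proof.
rewrite map_inj_uniq ?enum_uniq// => t u /addrI /polyP tu.
apply: eq_from_tnth => i; rewrite !(tnth_nth 0).
by have := tu i; rewrite !coef_Poly.
Qed.

Lemma size_monic_deg d : size (monic_deg F d) = (#|F| ^ d)%N.
Proof. by rewrite size_map -cardE card_tuple. Qed.

Lemma mem_irr_upto m P : (P \in irr_upto F m) =
  [&& P \is monic, (size P <= m.+1)%N & `[< irreducible_poly P >]].
Proof.
rewrite mem_filter; apply/andP/and3P => [[iP /flattenP[s]]|[mP sP iP]].
  move=> /mapP[d]; rewrite mem_iota/= add0n => dm -> /monic_degP[mP sP].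
  by rewrite mP sP.
have /asboolP[sP1 _] := iP.
split=> //; apply/flattenP; exists (monic_deg F (size P).-1).
  apply: map_f; rewrite mem_iota/= add0n -ltnS prednK// (ltn_trans _ sP1)//.
by apply/monic_degP; rewrite prednK// (ltn_trans _ sP1).
Qed.

Lemma irr_upto_uniq m : uniq (irr_upto F m).
Proof.
apply: filter_uniq; elim: (iota 0 m.+1) (iota_uniq 0 m.+1) => //= d s IH.
move=> /andP[ds us]; rewrite cat_uniq monic_deg_uniq IH//= andbT.
apply/hasPn => G /flattenP[t /mapP[e es ->]] /monic_degP[_ sG].
apply/negP => /monic_degP[_]; rewrite sG => -[ed].
by move: ds; rewrite -ed es.
Qed.

Lemma irreducible_dvdM P Q H : irreducible_poly P ->
  (P %| Q * H) = (P %| Q) || (P %| H).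
Proof.
move=> iP; case: (boolP (P %| Q)) => PQ /=; first by rewrite dvdp_mulr.
by rewrite Gauss_dvdpr// irreducible_poly_coprime.
Qed.

Lemma monic_irreducible_dvd P Q : P \is monic -> Q \is monic ->
  irreducible_poly P -> irreducible_poly Q -> P %| Q -> P = Q.
Proof.
move=> mP mQ [sP _] iQ PQ; apply/eqP; rewrite -eqp_monic//.
by apply: apply_irredp => //; rewrite gtn_eqF.
Qed.

Lemma exists_monic_irreducible G : (1 < size G)%N ->
  exists P, [/\ P \is monic, irreducible_poly P & P %| G].
Proof.
have [N] := ubnP (size G); elim: N G => // N IH G sN sG.
have [iG|] := pselect (irreducible_poly G).
  have G0 : lead_coef G != 0 by rewrite lead_coef_eq0 -size_poly_gt0 ltnW.
  have eG : (lead_coef G)^-1 *: G %= G by rewrite eqp_scale// invr_eq0.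
  exists ((lead_coef G)^-1 *: G); split.
  - by rewrite monicE lead_coefZ mulVf.
  - split; first by rewrite size_scale// invr_eq0.
    move=> Q sQ QG; rewrite (eqp_rtrans eG); apply: apply_irredp => //.
    by rewrite -(eqp_dvdr _ eG).
  - by rewrite (eqp_dvdl _ eG).
move=> /not_andP[//|/existsNP[Q]] /not_implyP[sQ] /not_implyP[QG nQ].
have G0 : G != 0 by rewrite -size_poly_gt0 ltnW.
have Q0 : Q != 0 by apply: contraNneq G0 => Q0; move: QG; rewrite Q0 dvd0p.
have sQG : (size Q < size G)%N.
  rewrite ltn_neqAle dvdp_leq// andbT dvdp_size_eqp//.
  by apply/negP => h; apply: nQ.
have [||P [mP iP PQ]] := IH Q.
- exact: leq_trans sQG sN.
- by rewrite ltn_neqAle eq_sym sQ size_poly_gt0.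
by exists P; split => //; exact: dvdp_trans PQ QG.
Qed.

Lemma count_multiples m Q : Q \is monic ->
  count (fun G => Q %| G) (monic_deg F m) =
  if ((size Q).-1 <= m)%N then (#|F| ^ (m - (size Q).-1))%N else 0%N.
Proof.
move=> mQ; have Q0 := monic_neq0 mQ.
have sQ : size Q = (size Q).-1.+1 by rewrite prednK// size_poly_gt0.
rewrite -size_filter; case: leqP => Qm; last first.
  apply/eqP; rewrite size_eq0 -[_ == _]negbK -has_filter; apply/negP => /hasP[G].
  move=> /monic_degP[mG sG] /(dvdp_leq (monic_neq0 mG)).
  by rewrite sQ sG ltnS leqNgt Qm.
rewrite -size_monic_deg -(size_map (fun H => Q * H) (monic_deg F (m - _))).
apply/perm_size/uniq_perm.
- by rewrite filter_uniq// monic_deg_uniq.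
- by rewrite map_inj_uniq ?monic_deg_uniq//; exact: mulfI.
move=> G; rewrite mem_filter; apply/andP/mapP => [[QG /monic_degP[mG sG]]|[H]].
  exists (G %/ Q); last by rewrite mulrC divpK.
  apply/monic_degP; split.
    by rewrite -(monicMr _ mQ) divpK// mulrC.
  by rewrite size_divp// sG -subSn.
move=> /monic_degP[mH sH] ->; rewrite dvdp_mulr//; split => //.
apply/monic_degP; split; first by rewrite monicMl.
by rewrite size_monicM ?monic_neq0// sH addnS/= {1}sQ addSn subnKC.
Qed.

Section UpTo.
Variable n : nat.
Notation irr := (irr_upto F n).
Notation I := 'I_(size irr).

Definition pr (i : I) : {poly F} := nth 0 irr i.
Definition dg (i : I) : nat := (size (pr i)).-1.

Lemma prP i : [/\ pr i \is monic, irreducible_poly (pr i) & (size (pr i) <= n.+1)%N].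
Proof.
have : pr i \in irr by apply: mem_nth.
by rewrite mem_irr_upto => /and3P[-> -> /asboolP ?].
Qed.

Lemma pr_monic i : pr i \is monic. Proof. by case: (prP i). Qed.
Lemma pr_irr i : irreducible_poly (pr i). Proof. by case: (prP i). Qed.
Lemma pr_neq0 i : pr i != 0. Proof. by rewrite monic_neq0// pr_monic. Qed.

Lemma dg_gt0 i : (0 < dg i)%N.
Proof. by case: (pr_irr i) => s _; rewrite /dg -ltnS prednK// (ltn_trans _ s). Qed.

Lemma size_pr i : size (pr i) = (dg i).+1.
Proof. by rewrite prednK// size_poly_gt0 pr_neq0. Qed.

Lemma dg_le i : (dg i <= n)%N.
Proof. by case: (prP i) => _ _; rewrite size_pr. Qed.

Lemma pr_inj : injective pr.
Proof.
move=> i j /eqP; rewrite nth_uniq ?irr_upto_uniq// => /eqP; exact: val_inj.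
Qed.

Lemma prE P : P \is monic -> irreducible_poly P -> (size P <= n.+1)%N ->
  exists i, P = pr i.
Proof.
move=> mP iP sP; have Pirr : P \in irr.
  by rewrite mem_irr_upto mP sP; apply/asboolP.
by exists (Ordinal (etrans (index_mem _ _) Pirr)); rewrite /pr/= nth_index.
Qed.

Lemma pr_dvd i j : (pr i %| pr j) = (i == j).
Proof.
apply/idP/eqP => [h|->//]; apply: pr_inj.
by apply: monic_irreducible_dvd; rewrite ?pr_monic//; exact: pr_irr.
Qed.

Lemma size_exp_pr i j : size (pr i ^+ j) = (j * dg i).+1.
Proof.
have := size_exp (pr i) j; rewrite /dg mulnC => <-.
by rewrite prednK// size_poly_gt0 expf_neq0// pr_neq0.
Qed.

(** Unique factorisation in counted form: for fixed i, the number of exponents 1, ..., n with a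
    power dividing G is the multiplicity of [pr i]. The induction splits off one irreducible
    factor. *)
Lemma sum_deg_pow_dvd m G : (m <= n)%N -> G \is monic -> size G = m.+1 ->
  (\sum_i \sum_(j < n) (pr i ^+ j.+1 %| G)%R * dg i)%N = m.
Proof.
elim/ltn_ind: m G => m IH G mn mG sG.
have [m0|m0] := posnP m.
  rewrite m0; apply: big1 => i _; apply: big1 => j _.
  have -> : pr i ^+ j.+1 %| G = false; last by [].
  apply/negP => /(dvdp_leq (monic_neq0 mG)); rewrite size_exp_pr sG m0 ltnS leqNgt.
  by rewrite muln_gt0 dg_gt0.
have [|P [mP iP PG]] := exists_monic_irreducible (G := G); first by rewrite sG.
have sPG := dvdp_leq (monic_neq0 mG) PG.
have [|i0 Pi] := prE mP iP; first by rewrite (leq_trans sPG)// sG.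
pose H := G %/ P.
have GE : G = P * H by rewrite mulrC divpK.
have mH : H \is monic by rewrite -(monicMr _ mP) mulrC -GE.
have d0 := dg_gt0 i0.
have d0m : (dg i0 <= m)%N by rewrite -ltnS -size_pr -Pi -sG.
have sH : size H = (m - dg i0).+1.
  have := size_monicM mP (monic_neq0 mH); rewrite -GE sG Pi size_pr addSn/=.
  by move: (size H) (monic_neq0 mH) => s; lia.
have := IH (m - dg i0)%N _ H _ mH sH.
rewrite ltn_subrL d0 m0 (leq_trans (leq_subr _ _) mn) => /(_ isT isT) IH'.
rewrite (bigD1 i0)//= in IH'; rewrite (bigD1 i0)//=.
have -> : (\sum_(i | i != i0) \sum_(j < n) (pr i ^+ j.+1 %| G)%R * dg i =
    \sum_(i | i != i0) \sum_(j < n) (pr i ^+ j.+1 %| H)%R * dg i)%N.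
  apply: eq_bigr => i ii; apply: eq_bigr => j _; congr (nat_of_bool _ * _)%N.
  rewrite GE Gauss_dvdpr// coprimep_expl// irreducible_poly_coprime.
    by rewrite Pi pr_dvd.
  exact: pr_irr.
suff : (\sum_(j < n) (pr i0 ^+ j.+1 %| G)%R * dg i0 =
    dg i0 + \sum_(j < n) (pr i0 ^+ j.+1 %| H)%R * dg i0)%N.
  by move=> ->; rewrite -addnA IH' subnKC.
have n0 : (0 < n)%N by apply: leq_trans mn.
have -> : (\sum_(j < n) (pr i0 ^+ j.+1 %| G)%R * dg i0 =
    \sum_(j < n) (pr i0 ^+ j %| H)%R * dg i0)%N.
  apply: eq_bigr => j _; congr (nat_of_bool _ * _)%N.
  by rewrite GE -Pi exprS dvdp_mul2l// monic_neq0.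
(* Dividing by P shifts the exponents by one. The exponent n needed at the top of the range
   contributes nothing, as H has degree below n. *)
have key : (pr i0 ^+ n %| H) = false.
  apply/negP => /(dvdp_leq (monic_neq0 mH)); rewrite size_exp_pr sH ltnS leqNgt.
  have : (n <= n * dg i0)%N by rewrite leq_pmulr.
  move: d0 m0 mn; move: (n * dg i0)%N (dg i0) => a b; lia.
case: n n0 key => // N _ key.
rewrite big_ord_recl/= expr0 dvd1p mul1n; congr (_ + _)%N.
by rewrite big_ord_recr/= key mul0n addn0.
Qed.

(** Gauss's formula. The degrees of the q^m monic polynomials of degree m sum to m * q^m; counted
    through the prime powers dividing them they sum to [f m]. The difference f (m + 1) - q * f m
    isolates the prime powers of degree m + 1 and equals q^(m + 1). *)
Lemma sum_irr_deg m : (0 < m)%N -> (m <= n)%N ->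
  (\sum_i \sum_(j < n) (j.+1 * dg i == m) * dg i)%N = (#|F| ^ m)%N.
Proof.
pose f m := (\sum_i \sum_(j < n)
  (if j.+1 * dg i <= m then #|F| ^ (m - j.+1 * dg i) else 0) * dg i)%N.
have fE e : (0 < e)%N -> (e <= n)%N -> f e = (e * #|F| ^ e)%N.
  move=> e0 en; rewrite -size_monic_deg.
  transitivity (\sum_(G <- monic_deg F e)
      \sum_i \sum_(j < n) (pr i ^+ j.+1 %| G)%R * dg i)%N; last first.
    rewrite big_seq (eq_bigr (fun=> e)); last first.
      by move=> G /monic_degP[mG sG]; exact: sum_deg_pow_dvd.
    by rewrite -big_seq big_const_seq count_predT iter_addn_0.
  rewrite exchange_big/=; apply: eq_bigr => i _.
  rewrite exchange_big/=; apply: eq_bigr => j _.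
  rewrite -big_distrl/=; congr (_ * _)%N.
  rewrite -big_mkcond/= sum1_count.
  by rewrite count_multiples ?monic_exp ?pr_monic// size_exp_pr.
have f0 : f 0%N = 0%N.
  apply: big1 => i _; apply: big1 => j _.
  by rewrite leqn0 muln_eq0/= (gtn_eqF (dg_gt0 i)).
case: m => // m _ mn.
have rec : f m.+1 = (#|F| * f m + \sum_i \sum_(j < n) (j.+1 * dg i == m.+1) * dg i)%N.
  rewrite /f big_distrr/= -big_split/=; apply: eq_bigr => i _.
  rewrite big_distrr/= -big_split/=; apply: eq_bigr => j _.
  rewrite mulnA -mulnDl; congr (_ * _)%N.
  move: (j.+1 * dg i)%N => a; case: (ltngtP a m.+1) => am.
  - by rewrite -ltnS am addn0 subSn ?expnS.
  - by rewrite leqNgt (ltn_trans _ am)//= muln0.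
  - by rewrite am ltnn muln0 subnn.
have := fE m.+1 isT mn; rewrite rec.
case: m mn rec => [|m] mn rec; first by rewrite f0 muln0 add0n mul1n.
rewrite fE ?(ltnW mn)// mulnCA -expnS [RHS]mulSn addnC => /addIn //.
Qed.

Notation cnt m := #|[set i | dg i == m]%SET|.

Lemma cnt_irr_le m : (m * cnt m <= #|F| ^ m)%N.
Proof.
have [->|m0] := posnP m; first by [].
have [mn|nm] := leqP m n; last first.
  rewrite (_ : cnt m = 0)%N ?muln0//; apply/eqP; rewrite cards_eq0; apply/eqP/setP => i.
  by rewrite !inE; apply/negbTE; rewrite neq_ltn (leq_ltn_trans (dg_le i) nm).
rewrite -(sum_irr_deg m0 mn) -sum1_card big_distrr/= big_mkcond/=.
apply: leq_sum => i _; rewrite inE; case: eqP => // dm.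
have n0 : (0 < n)%N by apply: leq_trans mn.
rewrite (bigD1 (Ordinal n0))//= mul1n dm eqxx mul1n muln1; exact: leq_addr.
Qed.

Lemma sum_pow_le (q h : nat) : (2 <= q)%N -> (2 * \sum_(1 <= e < h.+1) q ^ e <= q ^ (2 * h))%N.
Proof.
(* The extra 2 leaves 4 * a - 4 <= a^2 for a = q^h, which holds since (a - 2)^2 >= 0. *)
move=> q2; have H : (\sum_(1 <= e < h.+1) q ^ e + 2 <= 2 * q ^ h)%N.
  elim: h => [|h IH]; first by rewrite big_geq.
  by rewrite big_nat_recr//= expnS; move: IH; move: (q ^ h)%N (\sum_(_ <= _ < _) _)%N => a b; nia.
rewrite (mulnC 2 h) expnM -mulnn; move: H; move: (q ^ h)%N (\sum_(_ <= _ < _) _)%N => [|[|[|a]]] b; nia.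
Qed.

(** In [sum_irr_deg] the higher powers come from primes of degree at most m/2, each contributing its
    degree at most once. By [cnt_irr_le] they total at most the sum of q^e for 1 <= e <= m/2, hence
    at most half of q^m. *)
Lemma cnt_irr_ge m : (1 <= m <= n)%N -> (#|F| ^ m <= 2 * m * cnt m)%N.
Proof.
move=> /andP[m0 mn].
have q2 : (2 <= #|F|)%N by exact: finNzRing_gt1.
pose rest := (\sum_i (dg i <= m %/ 2) * dg i)%N.
have n0 : (0 < n)%N by apply: leq_trans mn.
have S : (#|F| ^ m <= m * cnt m + rest)%N.
  rewrite -(sum_irr_deg m0 mn) -sum1_card big_distrr/= [X in (_ <= X + _)%N]big_mkcond.
  rewrite /rest -big_split/=.
  apply: leq_sum => i _; rewrite inE.
  have u : (\sum_(j < n) (j.+1 * dg i == m) * dg i <= dg i)%N.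
    have [/existsP[j /eqP jm]|] := boolP [exists j : 'I_n, j.+1 * dg i == m]%N; last first.
      by rewrite negb_exists => /forallP h; rewrite big1// => j _; rewrite (negbTE (h j)).
    rewrite (bigD1 j)//= jm eqxx mul1n big1 ?addn0// => l lj.
    have -> : (l.+1 * dg i == m)%N = false; last by [].
    apply/negP => /eqP lm; move: lj; rewrite -val_eqE/=.
    have /eqP : (l.+1 * dg i = j.+1 * dg i)%N by rewrite lm jm.
    by rewrite eqn_pmul2r ?dg_gt0// eqSS => ->.
  case: eqP => dm; first by rewrite muln1 -{2}dm (leq_trans u)// dm leq_addr.
  rewrite add0n; case: (leqP (dg i) (m %/ 2)) => h; first by rewrite mul1n.
  rewrite mul0n leqn0 sum_nat_eq0; apply/forallP => j; apply/implyP => _.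
  have -> : (j.+1 * dg i == m)%N = false; last by [].
  apply/negP => /eqP jm; case: (nat_of_ord j) jm => [|l]; first by rewrite mul1n.
  by move: h; rewrite divn2 mulSn mulSn; move: (l * dg i)%N => a; lia.
have R2 : (2 * rest <= #|F| ^ m)%N.
  apply: (@leq_trans (#|F| ^ (2 * (m %/ 2)))); last first.
    by rewrite leq_exp2l// mulnC leq_trunc_div.
  apply: leq_trans (sum_pow_le _ q2); rewrite leq_mul2l/=.
  have -> : rest = (\sum_(i | (dg i < (m %/ 2).+1)%N) dg i)%N.
    rewrite /rest [RHS]big_mkcond; apply: eq_bigr => i _; rewrite ltnS.
    by case: leqP; rewrite ?mul1n ?mul0n.
  rewrite big_add1/= big_mkord.
  have dlt i : (dg i < (m %/ 2).+1)%N -> ((dg i).-1 < m %/ 2)%N.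
    by rewrite ltnS; case: (dg i) (dg_gt0 i).
  case E : (m %/ 2)%N => [|h].
    by rewrite big_pred0 ?big_ord0// => i; rewrite ltnS leqn0 (gtn_eqF (dg_gt0 i)).
  rewrite (partition_big (fun i => inord (dg i).-1 : 'I_h.+1) xpredT)//=.
  apply: leq_sum => e _; apply: leq_trans (cnt_irr_le e.+1).
  rewrite -sum1_card big_distrr/= [leqRHS]big_mkcond [leqLHS]big_mkcond/=.
  apply: leq_sum => i _; case: ifP => // /andP[di /eqP ie].
  have de : dg i = e.+1.
    rewrite -ie inordK ?prednK ?dg_gt0// -ltnS prednK ?dg_gt0//.
  by rewrite inE de eqxx muln1.
move: S R2; move: (#|F| ^ m)%N (cnt m) rest => a b c; lia.
Qed.

(** * Squarefree polynomials as sets of primes *)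

Definition prodP (A : {set I}) : {poly F} := \prod_(i in A) pr i.
Definition supp G : {set I} := [set i | pr i %| G]%SET.

Lemma prodP_monic A : prodP A \is monic.
Proof. by apply: monic_prod => i _; exact: pr_monic. Qed.

Lemma size_prodP A : size (prodP A) = (\sum_(i in A) dg i).+1.
Proof.
rewrite /prodP; pose K (x : {poly F}) (s : nat) := x \is monic /\ size x = s.+1.
suff : K (\prod_(i in A) pr i) (\sum_(i in A) dg i)%N by case.
apply: (big_rec2 K) => [|i s x _ [mx sx]]; first by split; rewrite ?monic1 ?size_poly1.
split; first by rewrite monicMl ?pr_monic.
by rewrite size_monicM ?pr_monic ?monic_neq0// sx size_pr addSn addnS.
Qed.

Lemma pr_dvd_prodP i A : (pr i %| prodP A) = (i \in A).
Proof.
apply/idP/idP => [|iA]; last by rewrite /prodP (bigD1 i)//= dvdp_mulr.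
apply: contraTT => iA; rewrite /prodP.
apply: (big_ind (fun x => ~~ (pr i %| x))) => [|x y nx ny|j jA].
- by rewrite dvdp1; case: (pr_irr i) => s _; rewrite gtn_eqF.
- by rewrite irreducible_dvdM ?negb_or ?nx//; exact: pr_irr.
- by rewrite pr_dvd; apply: contraNneq iA => ->.
Qed.

Lemma supp_prodP A : supp (prodP A) = A.
Proof. by apply/setP => i; rewrite inE pr_dvd_prodP. Qed.

Lemma prodP_squarefree A : squarefree (prodP A).
Proof.
move=> P iP; apply/negP => P2.
have PA : P %| prodP A by apply: dvdp_trans P2; rewrite exprS dvdp_mulr.
have [i iA Pi] : exists2 i, i \in A & P %| pr i.
  apply: contrapT => none; suff : ~~ (P %| prodP A) by rewrite PA.
  rewrite /prodP; apply: (big_ind (fun x => ~~ (P %| x))) => [|x y nx ny|j jA].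
  - by rewrite dvdp1; case: iP => s _; rewrite gtn_eqF.
  - by rewrite irreducible_dvdM ?negb_or ?nx.
  - by apply/negP => h; apply: none; exists j.
have eP : P %= pr i.
  by apply: apply_irredp Pi; [exact: pr_irr|case: iP => s _; rewrite gtn_eqF].
have : pr i ^+ 2 %| prodP A by rewrite -(eqp_dvdl _ (eqp_exp 2 eP)).
rewrite /prodP (finset.big_setD1 i)//= exprS expr1 dvdp_mul2l ?pr_neq0//.
by rewrite -/(prodP _) pr_dvd_prodP !inE eqxx.
Qed.

Lemma prodP_dvd G (A : {set I}) : A \subset supp G -> prodP A %| G.
Proof.
have [N] := ubnP #|A|; elim: N A => // N IH A AN AG.
have [->|/finset.set0Pn[i iA]] := eqVneq A finset.set0.
  by rewrite /prodP big_set0 dvd1p.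
rewrite /prodP (finset.big_setD1 i)//= Gauss_dvdp.
  have := fintype.subsetP AG i iA; rewrite inE => -> /=.
  apply: IH; first by move: AN; rewrite (finset.cardsD1 i) iA.
  by apply: fintype.subset_trans AG; apply/fintype.subsetP => j; rewrite !inE => /andP[].
rewrite irreducible_poly_coprime; last exact: pr_irr.
by rewrite -/(prodP _) pr_dvd_prodP !inE eqxx.
Qed.

(** The product divides G, so it suffices to compare degrees: for squarefree G only first powers
    survive in [sum_deg_pow_dvd]. *)
Lemma prodP_supp G : (0 < n)%N -> G \is monic -> size G = n.+1 -> squarefree G ->
  prodP (supp G) = G.
Proof.
move=> n0 mG sG sqG.
have dvd := prodP_dvd (fintype.subxx (mem (supp G))).
apply/eqP; rewrite -eqp_monic ?prodP_monic// -dvdp_size_eqp// size_prodP sG eqSS.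
apply/eqP; rewrite -[RHS](sum_deg_pow_dvd (leqnn n) mG sG) big_mkcond/=.
apply: eq_bigr => i _; rewrite inE (bigD1 (Ordinal n0))//= expr1 big1 ?addn0.
  by case: (pr i %| G); rewrite ?mul1n.
move=> j j0; have -> : pr i ^+ j.+1 %| G = false; last by [].
apply/negP => h; have /negP := sqG _ (pr_irr i); apply.
apply: dvdp_trans h; apply: dvdp_exp2l.
by move: j0; rewrite -val_eqE/=; case: (nat_of_ord j).
Qed.

Lemma card_supp G : size G = n.+1 -> nb_irr_factors G = #|supp G|.
Proof.
move=> sG; rewrite /nb_irr_factors sG /= -sum1_count (big_nth 0) big_mkord -sum1_card.
by apply: eq_bigl => i; rewrite inE.
Qed.

Lemma Pkn_perm k : (0 < n)%N ->
  perm_eq (Pkn F k n)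
    [seq prodP A | A <- enum [pred A : {set I} | (#|A| == k) && (\sum_(i in A) dg i == n)%N]].
Proof.
move=> n0; apply: uniq_perm.
- by rewrite filter_uniq// monic_deg_uniq.
- rewrite map_inj_uniq ?enum_uniq// => A B AB.
  by rewrite -(supp_prodP A) AB supp_prodP.
move=> G; rewrite mem_filter; apply/idP/mapP => [|[A]].
  move=> /andP[/andP[/asboolP sq /eqP kG]] /monic_degP[mG sG].
  exists (supp G); last by rewrite prodP_supp.
  rewrite mem_enum inE -card_supp// kG eqxx/= -eqSS -size_prodP prodP_supp//.
  by rewrite sG.
rewrite mem_enum inE => /andP[/eqP Ak /eqP An] ->.
have sA : size (prodP A) = n.+1 by rewrite size_prodP An.
rewrite card_supp// supp_prodP Ak eqxx andbT; apply/andP; split.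
  by apply/asboolP; exact: prodP_squarefree.
by apply/monic_degP; split => //; exact: prodP_monic.
Qed.

Lemma rad_mult_prodP (R : realType) (e : signs F n) A :
  rad_mult R e (prodP A) = chi R A e.
Proof.
rewrite /rad_mult; case: asboolP => [_|]; last by case; exact: prodP_squarefree.
by rewrite /chi; apply: eq_bigl => i; exact: pr_dvd_prodP.
Qed.

Lemma normalized_sumE (R : realType) k (e : signs F n) : (0 < n)%N ->
  normalized_sum R k.+1 e = (Num.sqrt (Ntot R dg n k))^-1 * chi_sum R dg n k e.
Proof.
move=> n0; have pe := Pkn_perm k.+1 n0; rewrite /normalized_sum; congr (_ * _).
  congr (Num.sqrt _)^-1; rewrite (perm_size pe) size_map -cardE /Ntot sumr_const.
  by congr (_ *+ _); apply: eq_card.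
rewrite (perm_big _ pe)/= big_map big_enum/=; apply: eq_bigr => A _.
exact: rad_mult_prodP.
Qed.

End UpTo.
End MonicPolynomials.

(** * Asymptotics and conclusion *)

Lemma cube_le_exp2 n : (10 <= n)%N -> (n ^ 3 <= 2 ^ n)%N.
Proof.
elim: n => // n IH; rewrite leq_eqVlt => /orP[/eqP <- //|].
rewrite ltnS => n10; have := IH n10.
rewrite (expnS 2 n) !expnS expn0; move: (2 ^ n)%N => a; nia.
Qed.

Lemma ln_le_harmonic (R : realType) n :
  ln (n.+1%:R : R) <= \sum_(m < n) m.+1%:R^-1.
Proof.
elim: n => [|n IH]; first by rewrite ln1 big_ord0.
rewrite big_ord_recr/=; apply: le_trans (_ : ln (n.+1%:R : R) + n.+1%:R^-1 <= _); last first.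
  by rewrite lerD2r.
have n0 : 0 < n.+1%:R :> R by rewrite ltr0n.
have -> : n.+2%:R = n.+1%:R * (1 + n.+1%:R^-1) :> R.
  by rewrite mulrDr mulr1 divff ?gt_eqF// natr1.
rewrite lnM ?posrE ?addr_gt0 ?invr_gt0//.
by rewrite lerD2l le_ln1Dx// (lt_le_trans (y := 0)) ?ltrN10// invr_ge0 ltW.
Qed.

(** By [cnt_irr_ge] the primes of degree m contribute at least 1 / (2 * m), half a term of the
    harmonic sum. *)
Lemma ln_le_sum_pow_dg (R : realType) (F : finFieldType) n : (0 < n)%N ->
  ln (n%:R : R) / 2 <= \sum_(i < size (irr_upto F n)) #|F|%:R^-1 ^+ dg i.
Proof.
move=> n0; have q1 : (1 < #|F|)%N by exact: finNzRing_gt1.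
have q0 : 0 < #|F|%:R :> R by rewrite ltr0n ltnW.
have p0 : 0 < #|F|%:R^-1 :> R by rewrite invr_gt0.
have dlt (i : 'I_(size (irr_upto F n))) : ((dg i).-1 < n)%N.
  by rewrite prednK ?dg_gt0 ?dg_le.
rewrite (partition_big (fun i => Ordinal (dlt i)) xpredT)//=.
apply: (@le_trans _ _ (\sum_(m < n) m.+1%:R^-1 / 2)).
  rewrite -mulr_suml ler_wpM2r//; case: n n0 {dlt} => // n _.
  apply: le_trans (ln_le_harmonic _ _); rewrite ler_ln ?posrE ?ltr0n// ler_nat.
  by [].
apply: ler_sum => m _.
have -> : \sum_(i < size (irr_upto F n) | Ordinal (dlt i) == m) #|F|%:R^-1 ^+ dg i =
   #|[set i : 'I_(size (irr_upto F n)) | dg i == m.+1]%SET|%:R * #|F|%:R^-1 ^+ m.+1 :> R.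
  rewrite -sum1_card natr_sum mulr_suml; apply: eq_big => [i|i /eqP im].
    by rewrite inE -val_eqE/= -(eqSS _ m) prednK// dg_gt0.
  by rewrite mul1r -(congr1 val im)/= prednK// dg_gt0.
have := @cnt_irr_ge F n m.+1; rewrite ltn0Sn ltn_ord => /(_ isT).
rewrite -(ler_nat R) !natrM natrX.
set c := #|_|%:R => H; rewrite exprVn ler_pdivlMr ?exprn_gt0//.
have m0 : 0 < m.+1%:R :> R by rewrite ltr0n.
rewrite -(ler_pM2l (x := 2 * m.+1%:R)) ?mulr_gt0//; apply: le_trans H.
by rewrite le_eqVlt; apply/orP; left; apply/eqP; field; rewrite gt_eqF.
Qed.

Lemma cvg_mean_heat (R : realType) (F : finFieldType) (k : nat -> nat) :
  (forall n, (1 <= k n)%N) ->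
  (fun n : nat => (k n)%:R / ln (n%:R : R)) @ \oo --> 0 ->
  forall s y : R, 0 < s ->
    (fun n => mean (fun e : signs F n => heat s (y - normalized_sum R (k n) e))) @ \oo
      --> heat (s + 1) y.
Proof.
move=> k1 kln s y s0; apply/cvgrPdist_le => e e0.
have q1 : (1 < #|F|)%N by exact: finNzRing_gt1.
have rs0 : 0 < Num.sqrt s by rewrite sqrtr_gt0.
have ss0 : 0 < s * Num.sqrt s by rewrite mulr_gt0.
(* [chi_sum_clt] will be used with th = t^2 and D = t. For t <= 1/6 one has sqrt (32 * th) <= 6 * t
   and 288 * th <= 48 * t, so its bound is at most t * C. *)
pose C := 6 / Num.sqrt s + 48 * `|y| / (s * Num.sqrt s) + 4 / (s * Num.sqrt s).
have C0 : 0 < C.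
  have h1 : 0 < 6 / Num.sqrt s by rewrite divr_gt0.
  have h2 : 0 <= 48 * `|y| / (s * Num.sqrt s) by rewrite divr_ge0 ?(ltW ss0)// mulr_ge0.
  have h3 : 0 < 4 / (s * Num.sqrt s) by rewrite divr_gt0.
  by rewrite addr_gt0// (lt_le_trans h1)// lerDl.
pose t := Num.min 6^-1 (e / C).
have t0 : 0 < t by rewrite lt_min invr_gt0 ltr0n divr_gt0.
have t6 : t <= 6^-1 by rewrite ge_min lexx.
have tC : t * C <= e by rewrite -ler_pdivlMr// ge_min lexx orbT.
pose th := t ^+ 2.
have th0 : 0 < th by rewrite exprn_gt0.
have th1 : th <= 32^-1.
  by have := ler_pM (ltW t0) (ltW t0) t6 t6; rewrite -expr2 -/th; lra.
(* The half pays for the half in [ln_le_sum_pow_dg]. *)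
have th2 : 0 < th / 2 by rewrite divr_gt0.
have bnd : Num.sqrt (32 * th) / Num.sqrt s + 4 / (s * Num.sqrt s) * t
    + `|y| / (s * Num.sqrt s) * (288 * th) <= e.
  apply: le_trans tC; rewrite /C !mulrDr.
  have h1 : Num.sqrt (32 * th) <= 6 * t.
    rewrite -[leRHS]ger0_norm ?mulr_ge0 ?(ltW t0)// -sqrtr_sqr ler_wsqrtr//.
    by rewrite exprMn -/th ler_wpM2r ?(ltW th0)//; lra.
  have h2 : 288 * th <= 48 * t.
    by have := ler_wpM2r (ltW t0) t6; rewrite -expr2 -/th; lra.
  rewrite addrAC; apply: lerD; last by rewrite mulrC.
  apply: lerD.
    rewrite (_ : t * (6 / _) = 6 * t / Num.sqrt s); last by ring.
    by rewrite ler_wpM2r ?invr_ge0 ?(ltW rs0).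
  rewrite (_ : t * _ = `|y| / (s * Num.sqrt s) * (48 * t)); last by ring.
  by rewrite ler_wpM2l// divr_ge0// ltW.
move/cvgrPdist_le : kln => /(_ _ th2) kln.
near=> n.
have n10 : (10 <= n)%N by near: n; exists 10%N.
have n0 : (0 < n)%N by apply: leq_trans n10.
have kn : `|0 - (k n)%:R / ln (n%:R : R)| <= th / 2 by near: n.
have nt : 16 / t ^+ 4 <= n%:R by near: n; exact: nbhs_infty_ger.
have ln0 : 0 < ln (n%:R : R) by rewrite ln_gt0// ltr1n (leq_trans _ n10).
have Lge := @ln_le_sum_pow_dg R F n n0.
set L := \sum_(i < _) _ in Lge.
have L0 : 0 < L by apply: lt_le_trans Lge; rewrite divr_gt0.
have kL : (k n).-1%:R <= th * L.
  have : (k n).-1%:R <= (k n)%:R :> R by rewrite ler_nat leq_pred.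
  move: kn; rewrite sub0r normrN ger0_norm ?divr_ge0 ?(ltW ln0)//.
  rewrite ler_pdivrMr// => h1 h2; apply: (le_trans h2); apply: (le_trans h1).
  by rewrite -mulrA ler_wpM2l ?(ltW th0)// mulrC.
have Dn : 16 * n%:R ^+ 2 <= t ^+ 4 * #|F|%:R ^+ n.
  apply: (@le_trans _ _ (t ^+ 4 * n%:R ^+ 3)).
    rewrite (exprS n%:R 2) mulrA ler_wpM2r ?sqr_ge0//.
    by move: nt; rewrite ler_pdivrMr ?exprn_gt0// mulrC.
  rewrite ler_wpM2l ?exprn_ge0 ?(ltW t0)// -!natrX ler_nat.
  by apply: (leq_trans (cube_le_exp2 n10)); rewrite leq_exp2r.
rewrite distrC.
rewrite (eq_mean (h := fun e : signs F n => heat s (y -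
   (Num.sqrt (Ntot R (@dg F n) n (k n).-1))^-1 * chi_sum R (@dg F n) n (k n).-1 e))); last first.
  by move=> e'; rewrite -normalized_sumE// prednK.
apply: le_trans bnd.
apply: (@chi_sum_clt R _ (@dg F n) #|F| n q1 (@dg_gt0 F n) (@cnt_irr_le F n)
  (@cnt_irr_ge F n) (k n).-1 n0 (@dg_le F n) th t s y) => //.
- by rewrite (ltW th0) th1.
- exact: ltW.
Unshelve. all: by end_near.
Qed.

Theorem theorem1p1 (R : realType) (F : finFieldType) (k : nat -> nat) :
  (forall n, (1 <= k n)%N) ->
  (fun n : nat => (k n)%:R / ln (n%:R : R)) @ \oo --> 0 ->
  forall x : R,
    (fun n : nat => (cdf_sum F (k n) n x)%:E) @ \oo -->
      normal_prob (0 : R) 1 `]-oo, x].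
Proof.
move=> k1 kln x; rewrite ncdfE; apply: cvg_EFin; first by apply: nearW.
exact: (@cvg_cdf_of_heat R (fun n => 'I_(size (irr_upto F n)))
  (fun n e => normalized_sum R (k n) e) (cvg_mean_heat F k1 kln)).
Qed.
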